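(* A general quadric surface $X=\{x\in\mathbb R^3\mid a_1x_1^2+a_2x_2^2+a_3x_3^2=1\}$ (with $a_1,a_2,a_3\in\mathbb R$ general) has $18$ complex critical curvature points. The number of real critical curvature points of $X$ is (i) $10$, if $X$ is an ellipsoid ($a_1,a_2,a_3$ are positive); (ii) $4$, if $X$ is a one-sheeted hyperboloid (two of the $a_i$ are positive and one is negative); (iii) $6$, if $X$ is a two-sheeted hyperboloid (one of the $a_i$ is positive and two are negative); (iv) $0$, if $X$ is empty ($a_1,a_2,a_3$ are negative).
   Context: ''General'' means that $(a_1,a_2,a_3)$ lies outside a proper Zariski closed subset of $\mathbb R^3$. For a real polynomial $f$ in $x=(x_1,x_2,x_3)$ let $\langle v,w\rangle=v^Tw$, let $\nabla f$ be the gradient, $\mathrm Hf$ the Hessian matrix, and $\eta(x)=\langle\nabla f(x),\nabla f(x)\rangle$. We write $\mathrm{Sing}(f)=\emptyset$ if $f=\partial f/\partial x_1=\partial f/\partial x_2=\partial f/\partial x_3=0$ has no solution in $\mathbb C^3$. For such $f$ with $X=\{f=0\}\subset\mathbb R^3$, the curvature variety is $$\mathcal C(f)=\{(x,\lambda,u,y)\in X\times\mathbb R\times\mathbb R^3\times\mathbb R^2 \mid \lambda^2\eta(x)=1,\ \langle u,\nabla f(x)\rangle=0,\ \langle u,u\rangle=1,\ \mathrm Hf(x)u+y_1u+y_2\nabla f(x)=0\},$$ with projection $\pi:\mathcal C(f)\to X$, $(x,\lambda,u,y)\mapsto x$, and $g(x,\lambda,u,y)=\lambda\,u^T\mathrm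 Hf(x)u$. A point $x\in X$ is a (real) critical curvature point if some $(x,\lambda,u,y)\in\pi^{-1}(x)$ is a critical point of $g$ on $\mathcal C(f)$; let $Cr(f)$ be the set of these points. Let $\mathcal P_{3,2}$ be the space of real polynomials in three variables of degree at most $2$, put $$Cr_{3,2}=\bigcup_{f\in\mathcal P_{3,2}:\ \mathrm{Sing}(f)=\emptyset}\{f\}\times Cr(f)\ \subset\ \mathcal P_{3,2}\times\mathbb R^3,$$ and let $\overline{Cr_{3,2}}$ be its complex Zariski closure (in $(\mathcal P_{3,2}\otimes\mathbb C)\times\mathbb C^3$). A complex critical curvature point of $X=\{f=0\}$ is a point $x\in\mathbb C^3$ with $(f,x)\in\overline{Cr_{3,2}}$. *)

(* Defs.v *)
From HB Require Import structures.
From mathcomp Require Import all_boot all_order all_algebra.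
From mathcomp Require Import mpoly complex.
From mathcomp Require Import classical_sets cardinality reals.

Set Implicit Arguments.
Unset Strict Implicit.
Unset Printing Implicit Defensive.

Import Order.TTheory GRing.Theory Num.Theory.
Local Open Scope ring_scope.
Local Open Scope classical_set_scope.

Definition dot (A : comNzRingType) (n : nat) (v w : 'cV[A]_n) : A :=
  (v^T *m w) 0 0.

(* Membership in the space of polynomials of degree at most d in n variables
   (msize is the total degree plus one). *)
Definition deg_le (n d : nat) (A : nzRingType) (f : {mpoly A[n]}) : Prop :=
  (msize f <= d.+1)%N.

Definition complexify (R : realType) (n : nat) (f : {mpoly R[n]}) :
  {mpoly R[i][n]} := map_mpoly (real_complex R) f.

Definition nonsingular (R : realType) (f : {mpoly R[3]}) : Prop :=
  ~ exists x : 'rV[R[i]]_3,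
      (complexify f).@[x 0] = 0 /\
      forall i : 'I_3, ((complexify f)^`M(i)).@[x 0] = 0.

(* The ambient space R^3 x R x R^3 x R^2 of the curvature variety is R^9, with
   its coordinates in the order x, lambda, u, y. *)
Notation amb := (3 + (1 + (3 + 2)))%N.

Section CurvatureVariety.
Variable R : realType.

Definition varx (i : 'I_3) : {mpoly R[amb]} := 'X_(lshift _ i).
Definition varlambda : {mpoly R[amb]} := 'X_(rshift 3 (lshift _ ord0)).
Definition varu : 'cV[{mpoly R[amb]}]_3 :=
  \col_(i < 3) 'X_(rshift 3 (rshift 1 (lshift 2 i))).
Definition vary (k : 'I_2) : {mpoly R[amb]} :=
  'X_(rshift 3 (rshift 1 (rshift 3 k))).

Definition in_x (h : {mpoly R[3]}) : {mpoly R[amb]} :=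
  h \mPo [tuple varx i | i < 3].

Definition grad (f : {mpoly R[3]}) : 'cV[{mpoly R[amb]}]_3 :=
  \col_(i < 3) in_x (f^`M(i)).

Definition hess (f : {mpoly R[3]}) : 'M[{mpoly R[amb]}]_3 :=
  \matrix_(i < 3, j < 3) in_x (f^`M(i)^`M(j)).

Definition principal_eq (f : {mpoly R[3]}) : 'cV[{mpoly R[amb]}]_3 :=
  hess f *m varu + vary ord0 *: varu + vary ord_max *: grad f.

Definition curvature_eqs (f : {mpoly R[3]}) : seq {mpoly R[amb]} :=
  [:: in_x f,
      varlambda ^+ 2 * dot (grad f) (grad f) - 1,
      dot varu (grad f),
      dot varu varu - 1
    & [seq principal_eq f i 0 | i <- enum 'I_3]].

Definition curvature_variety (f : {mpoly R[3]}) : set 'rV[R]_amb :=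
  [set p | forall h, h \in curvature_eqs f -> h.@[p 0] = 0].

Definition curvature_fun (f : {mpoly R[3]}) : {mpoly R[amb]} :=
  varlambda * dot varu (hess f *m varu).

Definition differential (n : nat) (h : {mpoly R[n]}) (p v : 'rV[R]_n) : R :=
  \sum_(k < n) (h^`M(k)).@[p 0] * v 0 k.

(* A critical point of g on C(f): the differential of g vanishes on the Zariski
   tangent space of C(f), cut out by the differentials of its equations. *)
Definition tangent_space (f : {mpoly R[3]}) (p : 'rV[R]_amb) :
    set 'rV[R]_amb :=
  [set v | forall h, h \in curvature_eqs f -> differential h p v = 0].

Definition is_critical (f : {mpoly R[3]}) (p : 'rV[R]_amb) : Prop :=
  curvature_variety f p /\
  forall v, tangent_space f p v -> differential (curvature_fun f) p v = 0.

(* lsubmx is the projection pi onto the x-coordinates. *)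
Definition Cr (f : {mpoly R[3]}) : set 'rV[R]_3 :=
  [set x | exists2 p : 'rV[R]_amb, is_critical f p & x = lsubmx p].

Definition grad_at (f : {mpoly R[3]}) (x : 'rV[R]_3) : 'cV[R]_3 :=
  \col_i (f^`M(i)).@[x 0].
Definition hess_at (f : {mpoly R[3]}) (x : 'rV[R]_3) : 'M[R]_3 :=
  \matrix_(i, j) (f^`M(i)^`M(j)).@[x 0].
Definition amb_point (x : 'rV[R]_3) (l : R) (u : 'cV[R]_3) (y1 y2 : R) : 'rV[R]_amb :=
  row_mx x (row_mx l%:M (row_mx u^T (row_mx y1%:M y2%:M))).

Section Coordinates.
Variables (x : 'rV[R]_3) (l : R) (u : 'cV[R]_3) (y1 y2 : R).
Local Notation p := (amb_point x l u y1 y2).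

Lemma ev_in_x h : (in_x h).@[p 0] = h.@[x 0].
Proof.
rewrite /in_x comp_mpoly_meval; apply: meval_eq => i.
by rewrite tnth_map tnth_ord_tuple mevalXU /amb_point row_mxEl.
Qed.

Lemma ev_l : varlambda.@[p 0] = l.
Proof. by rewrite mevalXU /amb_point row_mxEr row_mxEl mxE eqxx. Qed.

Lemma ev_u i : (varu i 0).@[p 0] = u i 0.
Proof. by rewrite mxE mevalXU /amb_point 2!row_mxEr row_mxEl mxE. Qed.

Lemma ev_y1 : (vary ord0).@[p 0] = y1.
Proof.
have e : (ord0 : 'I_2) = @lshift 1 1 ord0 by apply: val_inj.
rewrite /vary e mevalXU /amb_point 3!row_mxEr.
by rewrite ?(@row_mxEl _ 1 1 1) ?(@row_mxEr _ 1 1 1) mxE eqxx.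
Qed.

Lemma ev_y2 : (vary ord_max).@[p 0] = y2.
Proof.
have e : (ord_max : 'I_2) = @rshift 1 1 ord0 by apply: val_inj.
rewrite /vary e mevalXU /amb_point 3!row_mxEr.
by rewrite ?(@row_mxEl _ 1 1 1) ?(@row_mxEr _ 1 1 1) mxE eqxx.
Qed.

Lemma ev_dot (v w : 'cV[{mpoly R[amb]}]_3) (v' w' : 'cV[R]_3) :
  (forall i, (v i 0).@[p 0] = v' i 0) -> (forall i, (w i 0).@[p 0] = w' i 0) ->
  (dot v w).@[p 0] = dot v' w'.
Proof.
move=> hv hw; rewrite /dot !mxE raddf_sum; apply: eq_bigr => i _ /=.
by rewrite !mxE mevalM hv hw.
Qed.

Lemma ev_grad f i : (grad f i 0).@[p 0] = grad_at f x i 0.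
Proof. by rewrite !mxE ev_in_x. Qed.

Lemma ev_hessu f i : ((hess f *m varu) i 0).@[p 0] = (hess_at f x *m u) i 0.
Proof.
rewrite !mxE raddf_sum; apply: eq_bigr => j _ /=.
by rewrite mevalM ev_u !mxE ev_in_x.
Qed.

Lemma curvature_varietyP f : curvature_variety f p <->
  [/\ f.@[x 0] = 0,
     l ^+ 2 * dot (grad_at f x) (grad_at f x) = 1,
     dot u (grad_at f x) = 0, dot u u = 1
   & hess_at f x *m u + y1 *: u + y2 *: grad_at f x = 0].
Proof.
have E i : (principal_eq f i 0).@[p 0] =
  (hess_at f x *m u + y1 *: u + y2 *: grad_at f x) i 0.
  have sc (A : comNzRingType) (c : A) (v : 'cV[A]_3) : (c *: v) i 0 = c * v i 0 by rewrite mxE.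
  have ad (A : comNzRingType) (v w : 'cV[A]_3) : (v + w) i 0 = v i 0 + w i 0 by rewrite mxE.
  by rewrite /principal_eq !ad !sc !mevalD !mevalM ev_hessu ev_u ev_y1 ev_grad ev_y2.
have eg := ev_grad f.
have e2 := ev_dot eg eg.
have e3 := ev_dot ev_u eg.
have e4 := ev_dot ev_u ev_u.
split=> [H|[h1 h2 h3 h4 h5] h].
  split.
  - by rewrite -ev_in_x; apply: H; rewrite !inE eqxx.
  - have := H (varlambda ^+ 2 * dot (grad f) (grad f) - 1).
    rewrite !inE eqxx orbT => /(_ isT).
    by rewrite mevalB meval1 mevalM rmorphXn /= ev_l e2 => /eqP; rewrite subr_eq0 => /eqP.
  - by rewrite -e3; apply: H; rewrite !inE eqxx !orbT.
  - have := H (dot varu varu - 1).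
    rewrite !inE eqxx !orbT => /(_ isT).
    by rewrite mevalB meval1 e4 => /eqP; rewrite subr_eq0 => /eqP.
  - apply/matrixP => i j; rewrite (ord1 j) -E [RHS]mxE; apply: H.
    by rewrite !inE (map_f (fun i => principal_eq f i 0)) ?mem_enum ?orbT.
rewrite !inE => /or4P[/eqP->|/eqP->|/eqP->|/orP[/eqP->|/mapP[i _ ->]]].
- by rewrite ev_in_x.
- by rewrite mevalB meval1 mevalM rmorphXn /= ev_l e2 h2 subrr.
- by rewrite e3.
- by rewrite mevalB meval1 e4 h4 subrr.
- by rewrite E h5 mxE.
Qed.

Lemma curvature_funE f :
  (curvature_fun f).@[p 0] = l * dot u (hess_at f x *m u).
Proof.
have eh := ev_hessu f.
by rewrite mevalM ev_l (ev_dot ev_u eh).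
Qed.
End Coordinates.

End CurvatureVariety.

Definition zariski_closure (K : fieldType) (n : nat) (S : set 'rV[K]_n) :
    set 'rV[K]_n :=
  [set z | forall h : {mpoly K[n]},
     (forall s, S s -> h.@[s 0] = 0) -> h.@[z 0] = 0].

(* A pair (f, x), with f of degree at most 2, as a point of affine space:
   the coefficients of f at the ten monomials of degree < 3, followed by x. *)
Definition pair_coords (K : fieldType) (f : {mpoly K[3]}) (x : 'rV[K]_3) :
    'rV[K]_(#|{: 'X_{1..3 < 3}}| + 3) :=
  row_mx (\row_i f@_(enum_val i : 'X_{1..3 < 3})) x.

Section ComplexCriticalPoints.
Variable R : realType.

Definition Cr32 : set 'rV[R[i]]_(#|{: 'X_{1..3 < 3}}| + 3) :=
  [set z | exists (f : {mpoly R[3]}) (x : 'rV[R]_3),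
     [/\ deg_le 2 f, nonsingular f, Cr f x
       & z = pair_coords (complexify f) (map_mx (real_complex R) x)]].

Definition complex_Cr (f : {mpoly R[3]}) : set 'rV[R[i]]_3 :=
  [set x | zariski_closure Cr32 (pair_coords (complexify f) x)].

Definition quadric (a : 'rV[R]_3) : {mpoly R[3]} :=
  (\sum_(i < 3) a 0 i *: 'X_i ^+ 2) - 1.

End ComplexCriticalPoints.

Definition num_pos (R : realType) (a : 'rV[R]_3) : nat :=
  #|[set i : 'I_3 | 0 < a 0%R i]%SET|.

Definition num_neg (R : realType) (a : 'rV[R]_3) : nat :=
  #|[set i : 'I_3 | a 0%R i < 0]%SET|.

(* P holds for general a: there is a proper Zariski closed subset {q = 0},
   q <> 0, outside of which P holds.  (Every proper Zariski closed subset is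
   contained in such a hypersurface.) *)
Definition for_general (K : fieldType) (n : nat) (P : 'rV[K]_n -> Prop) : Prop :=
  exists2 q : {mpoly K[n]}, q != 0 & forall a : 'rV[K]_n, q.@[a 0] != 0 -> P a.

(* Main.v *)
(** Let n be the gradient and A the (constant) Hessian of a polynomial f of
degree at most 2 at a point x.  In an orthonormal frame u, v of the tangent
plane with u a principal direction, put k = uAu, m = vAv, p = uAn, q = vAn.
Eliminating the fibre coordinates, (x, lambda, u, y) is critical iff
k (3 al p + be q) = 0 whenever some c satisfies
(m - k) c <n, n> = al k q + be m p.
Hence a critical x is a vertex (An parallel to n), an umbilic (m = k) or a point
of zero Gauss curvature (k = 0); conversely vertices and umbilics are critical.

Each of the three conditions is polynomial in the coefficients of f and in x, so
it makes sense over C and bounds the closure of Cr_{3,2} from above.  On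
sum a_i x_i^2 = 1 the Gauss curvature does not vanish, the 6 vertices lie on
the axes, and the 12 umbilics lie on the coordinate planes, given by
x_i = 0, x_j^2 = a_k (a_i - a_j) / (a_i a_j (a_k - a_j)).  Conversely these points
belong to families of pairs (f, x) parametrised rationally, whose real members
are in Cr_{3,2}, so the complex members are in the closure.  The real points are
counted by the signs of the squares x_l^2. *)

Require Import Defs.
From HB Require Import structures.
From mathcomp Require Import all_boot all_order all_algebra.
From mathcomp Require Import mpoly complex.
From mathcomp Require Import classical_sets cardinality reals.
From mathcomp Require Import boolp finmap ring lra.

Set Implicit Arguments.
Unset Strict Implicit.
Unset Printing Implicit Defensive.

Import Order.TTheory GRing.Theory Num.Theory.
Local Open Scope ring_scope.
Local Open Scope card_scope.
Local Open Scope classical_set_scope.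

(** * The curvature variety in a frame *)

(** Constants and variables generate the polynomial ring. The later facts compatible with sums and
    products (chain rule, complexification, regularity along a curve) are proved by this
    induction. *)
Lemma mpoly_ring_ind (K : comNzRingType) n (P : {mpoly K[n]} -> Prop) :
  (forall c, P c%:MP) -> (forall i, P 'X_i) ->
  (forall g h, P g -> P h -> P (g + h)) ->
  (forall g h, P g -> P h -> P (g * h)) -> forall h, P h.
Proof.
move=> PC PX PD PM h; rewrite (mpolyE h).
have P0 : P 0 by rewrite -mpolyC0.
have P1 : P 1 by rewrite -mpolyC1.
apply: (big_ind P P0 PD) => m _; rewrite -mul_mpolyC; apply: (PM) => //.
rewrite mpolyXE_id; apply: (big_ind P P1 PM) => i _.
by elim: (m i) => [|k IH]; rewrite ?expr0 // exprS; apply: PM.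
Qed.

Section Differential.
Variables (R : realType) (n : nat) (p v : 'rV[R]_n).
Implicit Types g h : {mpoly R[n]}.

Lemma differentialC c : differential c%:MP p v = 0.
Proof. by rewrite /differential big1 // => i _; rewrite mderivC meval0 mul0r. Qed.

Lemma differentialX i : differential 'X_i p v = v 0 i.
Proof.
rewrite /differential (bigD1 i) //= big1 => [|j /negPf ji].
  by rewrite mderivX mevalZ mnm1E eqxx -{1}[U_(i)%MM]add0m addmK mpolyX0 meval1 !mul1r addr0.
by rewrite mderivX mnm1E eq_sym ji scale0r meval0 mul0r.
Qed.

Lemma differentialD g h :
  differential (g + h) p v = differential g p v + differential h p v.
Proof.
rewrite /differential -big_split; apply: eq_bigr => i _ /=.
by rewrite mderivD mevalD mulrDl.
Qed.

Lemma differentialM g h : differential (g * h) p v =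
  differential g p v * h.@[p 0] + g.@[p 0] * differential h p v.
Proof.
rewrite /differential mulr_suml mulr_sumr -big_split; apply: eq_bigr => i _ /=.
by rewrite mderivM mevalD !mevalM mulrDl mulrAC mulrA.
Qed.

Lemma differentialB1 h : differential (h - 1) p v = differential h p v.
Proof. by rewrite -mpolyC1 -mpolyCN differentialD differentialC addr0. Qed.

Lemma differential_sum (I : finType) (F : I -> {mpoly R[n]}) :
  differential (\sum_i F i) p v = \sum_i differential (F i) p v.
Proof.
apply: (big_morph (fun h => differential h p v)) => [g h|].
  exact: differentialD.
by rewrite -mpolyC0 differentialC.
Qed.

End Differential.

Section Dot.
Variables (A : comNzRingType) (n : nat).
Implicit Types (u v w : 'cV[A]_n) (M : 'M[A]_n).

Lemma dotE u v : dot u v = \sum_i u i 0 * v i 0.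
Proof. by rewrite /dot mxE; apply: eq_bigr => i _; rewrite mxE. Qed.

Lemma dotC u v : dot u v = dot v u.
Proof. by rewrite !dotE; apply: eq_bigr => i _; rewrite mulrC. Qed.

Lemma dotDr u v w : dot u (v + w) = dot u v + dot u w.
Proof. by rewrite /dot mulmxDr mxE. Qed.

Lemma dotZr u c v : dot u (c *: v) = c * dot u v.
Proof. by rewrite /dot -scalemxAr mxE. Qed.

Lemma dotDl u v w : dot (v + w) u = dot v u + dot w u.
Proof. by rewrite dotC dotDr ![dot u _]dotC. Qed.

Lemma dotZl u c v : dot (c *: v) u = c * dot v u.
Proof. by rewrite dotC dotZr dotC. Qed.

Lemma dot0r u : dot u 0 = 0.
Proof. by rewrite /dot mulmx0 mxE. Qed.

Lemma dot_sym M u v : M^T = M -> dot u (M *m v) = dot v (M *m u).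
Proof. by move=> sM; rewrite dotC /dot trmx_mul sM mulmxA. Qed.

Lemma dot_delta i u : dot (delta_mx i 0) u = u i 0.
Proof.
rewrite dotE (bigD1 i) //= big1 => [|j /negPf ji]; rewrite mxE ?eqxx ?ji ?mul0r //.
by rewrite mul1r addr0.
Qed.

End Dot.

Section CurvatureTangent.
Variables (R : realType) (f : {mpoly R[3]}).
Variables (x : 'rV[R]_3) (l : R) (u : 'cV[R]_3) (y1 y2 : R).
Variables (dx : 'rV[R]_3) (dl : R) (du : 'cV[R]_3) (dy1 dy2 : R).
Hypothesis f2 : deg_le 2 f.
Let p := amb_point x l u y1 y2.
Let v := amb_point dx dl du dy1 dy2.
Let n := grad_at f x.
Let A := hess_at f x.

Lemma hess_at_sym : A^T = A.
Proof. by apply/matrixP => i j; rewrite !mxE mderiv_comm. Qed.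

(** Chain rule: a polynomial in x alone only sees the x-component of a tangent vector. *)
Lemma differential_in_x h :
  differential (in_x h) p v = \sum_i (h^`M(i)).@[x 0] * dx 0 i.
Proof.
change (differential (in_x h) p v = differential h x dx).
elim/mpoly_ring_ind: h => [c|i|g h Hg Hh|g h Hg Hh].
- by rewrite /in_x comp_mpolyC !differentialC.
- rewrite differentialX /in_x comp_mpolyXU -tnth_nth tnth_map tnth_ord_tuple.
  by rewrite differentialX /v /amb_point row_mxEl.
- by rewrite /in_x raddfD !differentialD Hg Hh.
- by rewrite /in_x rmorphM /= !differentialM -!/(in_x _) Hg Hh /p !ev_in_x.
Qed.

Lemma differential_varu i : differential (varu R i 0) p v = du i 0.
Proof. by rewrite -(ev_u dx dl du dy1 dy2) mxE differentialX mevalXU. Qed.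

Lemma differential_grad i :
  differential (grad f i 0) p v = (A *m dx^T) i 0.
Proof.
rewrite mxE differential_in_x mxE; apply: eq_bigr => j _.
by rewrite !mxE.
Qed.

(** The coefficients of a third derivative come from monomials of degree at least 3, of which [f]
    has none. Thus the Hessian is constant and contributes no term of its own to the differentials
    below. *)
Lemma mderiv3_eq0 i j k : f^`M(i)^`M(j)^`M(k) = 0.
Proof.
have -> : f^`M(i)^`M(j)^`M(k) = f^`M[U_(i) + U_(j) + U_(k)].
  by rewrite !mderivmDm !mderivmU1m.
apply/mpolyP => m; rewrite mcoeff_mderivm mcoeff0.
have /negPf : (U_(i) + U_(j) + U_(k) + m)%MM \notin msupp f.
  by apply: msize_mdeg_ge; rewrite !mdegD !mdeg1; apply: leq_trans f2 _.
by rewrite mcoeff_msupp => /negbFE/eqP ->; rewrite mul0rn.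
Qed.

Lemma differential_hessu i :
  differential ((hess f *m varu R) i 0) p v = (A *m du) i 0.
Proof.
rewrite !mxE differential_sum; apply: eq_bigr => j _.
rewrite differentialM differential_varu !mxE differential_in_x ev_in_x big1 ?mul0r ?add0r//.
by move=> k _; rewrite mderiv3_eq0 meval0 mul0r.
Qed.

Lemma differential_dot (V W : 'cV[{mpoly R[amb]}]_3) (V' W' dV dW : 'cV[R]_3) :
  (forall i, (V i 0).@[p 0] = V' i 0) -> (forall i, (W i 0).@[p 0] = W' i 0) ->
  (forall i, differential (V i 0) p v = dV i 0) ->
  (forall i, differential (W i 0) p v = dW i 0) ->
  differential (dot V W) p v = dot dV W' + dot V' dW.
Proof.
move=> hV hW hdV hdW; rewrite !dotE differential_sum -big_split.
by apply: eq_bigr => i _ /=; rewrite differentialM hV hW hdV hdW.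
Qed.

Lemma differential_varlambda : differential (varlambda R) p v = dl.
Proof. by rewrite -(ev_l dx dl du dy1 dy2) differentialX mevalXU. Qed.

Lemma differential_vary1 : differential (vary R ord0) p v = dy1.
Proof. by rewrite -(ev_y1 dx dl du dy1 dy2) differentialX mevalXU. Qed.

Lemma differential_vary2 : differential (vary R ord_max) p v = dy2.
Proof. by rewrite -(ev_y2 dx dl du dy1 dy2) differentialX mevalXU. Qed.

(** The equations of the curvature variety, linearised by the product rule. The second and the
    fourth acquire a factor 2, which is cancelled. *)
Lemma tangent_spaceP : tangent_space f p v <->
  [/\ dot n dx^T = 0,
     l * dl * dot n n + l ^+ 2 * dot n (A *m dx^T) = 0,
     dot du n + dot u (A *m dx^T) = 0, dot u du = 0
   & A *m du + dy1 *: u + y1 *: du + dy2 *: n + y2 *: (A *m dx^T) = 0].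
Proof.
have eu := ev_u x l u y1 y2; have eg := ev_grad x l u y1 y2 f.
have two0 : (2%:R : R) != 0 by rewrite pnatr_eq0.
have d1 : differential (in_x f) p v = dot n dx^T.
  by rewrite differential_in_x dotE; apply: eq_bigr => i _; rewrite !mxE.
have d2 : differential (varlambda R ^+ 2 * dot (grad f) (grad f) - 1) p v =
    2%:R * (l * dl * dot n n + l ^+ 2 * dot n (A *m dx^T)).
  rewrite differentialB1 differentialM expr2 differentialM differential_varlambda.
  rewrite mevalM /p !ev_l (ev_dot eg eg).
  rewrite (differential_dot eg eg differential_grad differential_grad).
  by rewrite [dot (A *m _) _]dotC -/n; ring.
have d3 : differential (dot (varu R) (grad f)) p v = dot du n + dot u (A *m dx^T).
  exact: (differential_dot eu eg differential_varu differential_grad).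
have d4 : differential (dot (varu R) (varu R) - 1) p v = 2%:R * dot u du.
  rewrite differentialB1 (differential_dot eu eu differential_varu differential_varu).
  by rewrite [dot du u]dotC; ring.
have d5 i : differential (principal_eq f i 0) p v =
    (A *m du + dy1 *: u + y1 *: du + dy2 *: n + y2 *: (A *m dx^T)) i 0.
  have sc (B : comNzRingType) (c : B) (w : 'cV[B]_3) : (c *: w) i 0 = c * w i 0.
    by rewrite mxE.
  have ad (B : comNzRingType) (w w' : 'cV[B]_3) : (w + w') i 0 = w i 0 + w' i 0.
    by rewrite mxE.
  rewrite /principal_eq !ad !sc !differentialD !differentialM differential_hessu.
  rewrite differential_varu differential_grad differential_vary1 differential_vary2.
  by rewrite /p ev_y1 ev_y2 ev_u ev_grad !addrA.
split=> [H|[h1 h2 h3 h4 h5] h].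
  split.
  - by rewrite -d1; apply: H; rewrite !inE eqxx.
  - apply: (mulfI two0); rewrite mulr0 -d2; apply: H.
    by rewrite !inE eqxx orbT.
  - by rewrite -d3; apply: H; rewrite !inE eqxx !orbT.
  - apply: (mulfI two0); rewrite mulr0 -d4; apply: H.
    by rewrite !inE eqxx !orbT.
  - apply/matrixP => i j; rewrite (ord1 j) -d5 [RHS]mxE; apply: H.
    by rewrite !inE (map_f (fun i => principal_eq f i 0)) ?mem_enum ?orbT.
rewrite !inE => /or4P[/eqP->|/eqP->|/eqP->|/orP[/eqP->|/mapP[i _ ->]]].
- by rewrite d1.
- by rewrite d2 h2 mulr0.
- by rewrite d3.
- by rewrite d4 h4 mulr0.
- by rewrite d5 h5 mxE.
Qed.

Lemma differential_curvature_fun : differential (curvature_fun f) p v =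
  dl * dot u (A *m u) + l * (2%:R * dot du (A *m u)).
Proof.
have eu := ev_u x l u y1 y2; have eh := ev_hessu x l u y1 y2 f.
rewrite /curvature_fun differentialM differential_varlambda /p ev_l (ev_dot eu eh).
rewrite (differential_dot eu eh differential_varu differential_hessu) -/A.
by rewrite (dot_sym u du hess_at_sym); ring.
Qed.

End CurvatureTangent.

Lemma amb_point_ex (R : realType) (p : 'rV[R]_amb) :
  exists x l u y1 y2, p = amb_point x l u y1 y2.
Proof.
have h1 (B : 'M[R]_1) : (B 0 0)%:M = B by rewrite -mx11_scalar.
exists (lsubmx p), (lsubmx (rsubmx p) 0 0), (lsubmx (rsubmx (rsubmx p)))^T.
exists ((lsubmx (rsubmx (rsubmx (rsubmx p)) : 'rV_(1 + 1))) 0 0).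
exists ((rsubmx (rsubmx (rsubmx (rsubmx p)) : 'rV_(1 + 1))) 0 0).
by rewrite /amb_point trmxK !h1 !hsubmxK.
Qed.

(** For distinct indices this is, up to sign, the cross product of [n] with a basis vector. Unlike
    an orthonormal frame, these tangent vectors depend polynomially on [n], so they make sense over
    C and on a Zariski closure. *)
Definition tau (K : comNzRingType) (n : 'cV[K]_3) (e : 'I_3 * 'I_3) : 'cV[K]_3 :=
  n e.1 0 *: delta_mx e.2 0 - n e.2 0 *: delta_mx e.1 0.

(* The factors vanish, for all indices, at vertices, umbilics and points of zero
   Gauss curvature respectively: the second one compares the second fundamental
   form with the metric on the vectors tau, which span the tangent plane, and
   the third one is a minor of the second fundamental form. *)
Definition obstruction (K : comNzRingType) (n : 'cV[K]_3) (A : 'M[K]_3)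
    (a b c d e g h : 'I_3 * 'I_3) : K :=
  dot (tau n a) (A *m n) *
  (dot (tau n b) (A *m tau n c) * dot (tau n d) (tau n e) -
   dot (tau n d) (A *m tau n e) * dot (tau n b) (tau n c)) *
  (dot (tau n g) (A *m tau n g) * dot (tau n h) (A *m tau n h) -
   dot (tau n g) (A *m tau n h) ^+ 2).

Lemma dot_tau (K : comNzRingType) (n : 'cV[K]_3) e : dot n (tau n e) = 0.
Proof.
by rewrite /tau -scaleNr dotDr !dotZr ![dot n _]dotC !dot_delta; ring.
Qed.

Section Morphism.
Variables (K L : comNzRingType) (phi : {rmorphism K -> L}).

Lemma rmorph_dot n (u v : 'cV[K]_n) :
  phi (dot u v) = dot (map_mx phi u) (map_mx phi v).
Proof.
by rewrite !dotE rmorph_sum; apply: eq_bigr => i _; rewrite rmorphM !mxE.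
Qed.

Lemma map_tau (n : 'cV[K]_3) e : map_mx phi (tau n e) = tau (map_mx phi n) e.
Proof. by rewrite /tau map_mxB !map_mxZ !map_delta_mx !mxE. Qed.

(** Applied to the evaluation of polynomials and to the inclusion of R in C. *)
Lemma rmorph_obstruction (n : 'cV[K]_3) (A : 'M[K]_3) a b c d e g h :
  phi (obstruction n A a b c d e g h) =
  obstruction (map_mx phi n) (map_mx phi A) a b c d e g h.
Proof.
rewrite /obstruction expr2 !(rmorphM, rmorphB) /=.
by rewrite !rmorph_dot !map_mxM !map_tau -?expr2.
Qed.

End Morphism.

Definition cross (K : comNzRingType) (u v : 'cV[K]_3) : 'cV[K]_3 :=
  \col_i [:: u 1 0 * v 2%:R 0 - u 2%:R 0 * v 1 0;
             u 2%:R 0 * v 0 0 - u 0 0 * v 2%:R 0;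
             u 0 0 * v 1 0 - u 1 0 * v 0 0]`_i.

Lemma sum3 (V : nmodType) (F : 'I_3 -> V) : \sum_i F i = F 0 + F 1 + F 2%:R.
Proof.
rewrite !big_ord_recl big_ord0 addr0 addrA.
by congr (F _ + F _ + F _); apply: val_inj.
Qed.

Section Cross.
Variables (K : comNzRingType) (u v : 'cV[K]_3).

Lemma dot_crossl : dot u (cross u v) = 0.
Proof. by rewrite dotE sum3 !mxE /=; ring. Qed.

Lemma dot_crossr : dot v (cross u v) = 0.
Proof. by rewrite dotE sum3 !mxE /=; ring. Qed.

Lemma dot_cross_cross :
  dot (cross u v) (cross u v) = dot u u * dot v v - dot u v ^+ 2.
Proof. by rewrite !dotE !sum3 !mxE /=; ring. Qed.

End Cross.

Section Frame.
Variables (R : realType) (u v n : 'cV[R]_3) (l : R).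
Hypotheses (uu : dot u u = 1) (vv : dot v v = 1) (uv : dot u v = 0).
Hypotheses (un : dot u n = 0) (vn : dot v n = 0) (ln : l ^+ 2 * dot n n = 1).

Lemma frame_eta_neq0 : dot n n != 0.
Proof. by apply/eqP => h; move: ln; rewrite h mulr0 => /esym/eqP; rewrite oner_eq0. Qed.

(** The vectors u, v and l n are orthonormal, so the matrix [Q] with these rows is orthogonal, and
    [Q] w = 0 forces w = 0. *)
Lemma frame_ext (w : 'cV[R]_3) :
  dot u w = 0 -> dot v w = 0 -> dot n w = 0 -> w = 0.
Proof.
move=> uw vw nw.
pose c (i : 'I_3) := [:: u; v; l *: n]`_i.
pose Q := \matrix_(i, j) c i j 0.
have dc i (z : 'cV[R]_3) : (Q *m z) i 0 = dot (c i) z.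
  by rewrite mxE dotE; apply: eq_bigr => j _; rewrite mxE.
have QQ : Q *m Q^T = 1%:M.
  apply/matrixP => i j.
  have -> : (Q *m Q^T) i j = dot (c i) (c j).
    by rewrite mxE dotE; apply: eq_bigr => k _; rewrite !mxE.
  rewrite [RHS]mxE -val_eqE /=.
  case: i => [[|[|[|i]]] hi] //=; case: j => [[|[|[|j]]] hj] //=;
    rewrite /c /= ?dotZl ?dotZr ?uu ?vv ?uv ?un ?vn ?mulr0 //.
  - by rewrite dotC uv.
  - by rewrite dotC un mulr0.
  - by rewrite dotC vn mulr0.
  - by rewrite mulrA -expr2 ln.
have /mulmx1C QTQ := QQ.
have Qw : Q *m w = 0.
  apply/matrixP => i j; rewrite (ord1 j) dc mxE /c.
  by case: i => [[|[|[|i]]] hi] //=; rewrite dotZl nw mulr0.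
by rewrite -[w]mul1mx -QTQ -mulmxA Qw mulmx0.
Qed.

Lemma frame_expansion (w : 'cV[R]_3) :
  w = dot u w *: u + dot v w *: v + (dot n w / dot n n) *: n.
Proof.
have e0 := frame_eta_neq0.
apply/eqP; rewrite -subr_eq0; apply/eqP.
rewrite -scaleN1r; apply: frame_ext;
  rewrite !(dotDr, dotZr) ?uu ?vv ?uv ?un ?vn ?(dotC v u) ?(dotC n u) ?(dotC n v)
    ?uv ?un ?vn; by field.
Qed.

End Frame.

(** * Criticality expressed in a principal frame *)

Section Critical.
Variables (R : realType) (f : {mpoly R[3]}).
Variables (x : 'rV[R]_3) (l : R) (u v : 'cV[R]_3) (y1 y2 : R).
Hypothesis f2 : deg_le 2 f.
Let n := grad_at f x.
Let A := hess_at f x.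
Hypotheses (uu : dot u u = 1) (vv : dot v v = 1) (uv : dot u v = 0).
Hypotheses (un : dot u n = 0) (vn : dot v n = 0) (ln : l ^+ 2 * dot n n = 1).
Hypothesis principal : A *m u + y1 *: u + y2 *: n = 0.
Let k := dot u (A *m u).
Let m := dot v (A *m v).
Let p := dot u (A *m n).
Let q := dot v (A *m n).
Let e0 : dot n n != 0 := frame_eta_neq0 ln.
Let sA : A^T = A := hess_at_sym f x.

(** Pairing the principal equation with u, n and v in turn determines y1 and y2 and shows that u and
    v are conjugate directions. *)
Lemma principal_y1 : y1 = - k.
Proof.
have := congr1 (dot u) principal.
by rewrite !dotDr !dotZr uu un dot0r mulr1 mulr0 addr0 addrC => /eqP; rewrite addr_eq0 => /eqP.
Qed.

Lemma principal_y2 : y2 = - p / dot n n.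
Proof.
have := congr1 (dot n) principal.
rewrite !dotDr !dotZr dot0r (dotC n u) un mulr0 addr0 (dot_sym n u sA) -/p addrC.
by move/eqP; rewrite addr_eq0 => /eqP <-; rewrite mulfK.
Qed.

Lemma principal_v : dot v (A *m u) = 0.
Proof.
have := congr1 (dot v) principal.
by rewrite !dotDr !dotZr (dotC v u) uv vn dot0r !mulr0 !addr0.
Qed.

(** A tangent vector has dx = al u + be v and du = c v - (al k / <n,n>) n, and its other components
    are determined by these. The only condition left is the v-component of the linearised principal
    equation, which is the relation between al, be and c. On such a vector the differential of g is
    -(l / <n,n>) k (3 al p + be q). *)
Lemma critical_frame :
  (forall w, tangent_space f (amb_point x l u y1 y2) w ->
     differential (curvature_fun f) (amb_point x l u y1 y2) w = 0) <->
  (forall al be c : R, (m - k) * c * dot n n = al * k * q + be * m * p ->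
     k * (3%:R * al * p + be * q) = 0).
Proof.
have vAu := principal_v; have Y1 := principal_y1; have Y2 := principal_y2.
have uAv : dot u (A *m v) = 0 by rewrite (dot_sym _ _ sA).
have nAu : dot n (A *m u) = p by rewrite (dot_sym _ _ sA).
have nAv : dot n (A *m v) = q by rewrite (dot_sym _ _ sA).
have l0 : l != 0.
  by apply/eqP => h; move: ln; rewrite h expr0n mul0r => /esym/eqP; rewrite oner_eq0.
have vu : dot v u = 0 by rewrite dotC.
have nu : dot n u = 0 by rewrite dotC.
have nv : dot n v = 0 by rewrite dotC.
have dE := (uu, vv, uv, vu, un, nu, vn, nv, vAu, uAv, nAu, nAv).
split=> [H al be c hc|H w].
  pose dX := al *: u + be *: v.
  pose du := c *: v - (al * k / dot n n) *: n.
  (* [w0] is the linearised principal equation without its terms in dy1 and dy2. These two are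
     chosen to cancel its components along u and n; the one along v vanishes by the relation on al,
     be and c. The value of [dl] solves the linearised normalisation of lambda. *)
  pose w0 := A *m du + y1 *: du + y2 *: (A *m dX).
  pose dl := - l * (al * p + be * q) / dot n n.
  have := H (amb_point dX^T dl du (- dot u w0) (- dot n w0 / dot n n)).
  rewrite tangent_spaceP // differential_curvature_fun // trmxK -/n -/A.
  have du_n : dot du n = - al * k.
    by rewrite /du -scaleNr dotDl !dotZl vn; field.
  have nAX : dot n (A *m dX) = al * p + be * q.
    by rewrite /dX mulmxDr -!scalemxAr dotDr !dotZr !dE.
  have uAX : dot u (A *m dX) = al * k.
    by rewrite /dX mulmxDr -!scalemxAr dotDr !dotZr !dE -/k; ring.
  have vAX : dot v (A *m dX) = be * m.
    by rewrite /dX mulmxDr -!scalemxAr dotDr !dotZr !dE -/m; ring.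
  have duAu : dot du (A *m u) = - al * k * p / dot n n.
    by rewrite /du -scaleNr dotDl !dotZl !dE; field.
  have vw0 : dot v w0 = 0.
    rewrite /w0 /du -scaleNr mulmxDr -!scalemxAr !(dotDr, dotZr) vAX !dE -/m -/q Y1 Y2.
    rewrite (_ : _ + _ =
        ((m - k) * c * dot n n - (al * k * q + be * m * p)) / dot n n); last by field.
    by rewrite hc subrr mul0r.
  move=> dg.
  have {dg} : dl * dot u (A *m u) + l * (2%:R * dot du (A *m u)) = 0.
    apply: dg; split.
    - by rewrite /dX dotDr !dotZr !dE; ring.
    - by rewrite nAX /dl; field.
    - by rewrite du_n uAX; ring.
    - by rewrite /du -scaleNr dotDr !dotZr !dE; ring.
    - have -> : A *m du + - dot u w0 *: u + y1 *: du + (- dot n w0 / dot n n) *: n +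
          y2 *: (A *m dX) = w0 + (- dot u w0 *: u + (- dot n w0 / dot n n) *: n).
        rewrite /w0 (addrAC (A *m du)) (addrAC _ ((- dot n w0 / dot n n) *: n)).
        by rewrite (addrAC _ _ (y2 *: (A *m dX))) addrA.
      clearbody w0; apply: (@frame_ext _ u v n l) => //; rewrite !(dotDr, dotZr) !dE ?vw0; by field.
  rewrite duAu -/k /dl => dg0.
  have : - (l / dot n n) * (k * (3%:R * al * p + be * q)) = 0.
    by rewrite -[RHS]dg0; field.
  move/eqP; rewrite mulf_eq0 oppr_eq0 mulf_eq0 invr_eq0 (negPf l0) (negPf e0).
  by move/eqP.
(* Conversely, al, be and c are read off an arbitrary tangent vector as its components along u and
   v. *)
have [dx [dl [du [dy1 [dy2 ->]]]]] := amb_point_ex w.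
rewrite tangent_spaceP // differential_curvature_fun // -/n -/A.
move: (dx^T) => dX [ndX dlE du_n udu tan].
have dXE : dX = dot u dX *: u + dot v dX *: v.
  by rewrite {1}(frame_expansion uu vv uv un vn ln dX) ndX mul0r scale0r addr0.
move: (dot u dX) (dot v dX) dXE => al be dXE.
have nAX : dot n (A *m dX) = al * p + be * q.
  by rewrite dXE mulmxDr -!scalemxAr dotDr !dotZr !dE.
have uAX : dot u (A *m dX) = al * k.
  by rewrite dXE mulmxDr -!scalemxAr dotDr !dotZr !dE -/k; ring.
have vAX : dot v (A *m dX) = be * m.
  by rewrite dXE mulmxDr -!scalemxAr dotDr !dotZr !dE -/m; ring.
have duE : du = dot v du *: v - (al * k / dot n n) *: n.
  rewrite {1}(frame_expansion uu vv uv un vn ln du) udu scale0r add0r -scaleNr.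
  congr (_ + _ *: _); rewrite dotC; move/eqP: du_n; rewrite addr_eq0 => /eqP ->.
  by rewrite uAX mulNr.
move: (dot v du) duE => c duE.
have duAu : dot du (A *m u) = - al * k * p / dot n n.
  by rewrite duE -scaleNr dotDl !dotZl !dE; field.
have hc : (m - k) * c * dot n n = al * k * q + be * m * p.
  have := congr1 (dot v) tan.
  rewrite duE -scaleNr mulmxDr -!scalemxAr !(dotDr, dotZr) vAX !dE dot0r -/m -/q Y1 Y2.
  move=> /(congr1 (fun z => z * dot n n)); rewrite mul0r => h.
  apply/eqP; rewrite -subr_eq0; apply/eqP; rewrite -[RHS]h.
  by field.
have dlE' : dl = - l * (al * p + be * q) / dot n n.
  move: dlE; rewrite nAX => h; apply: (mulIf e0); apply: (mulfI l0).
  rewrite mulrA; apply/eqP; rewrite -subr_eq0; apply/eqP; rewrite -[RHS]h.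
  by field.
rewrite duAu dlE' -/k.
rewrite (_ : _ + _ = - (l / dot n n) * (k * (3%:R * al * p + be * q))).
  by rewrite (H al be c) // mulr0.
by field.
Qed.

End Critical.

Section CrDegree2.
Variables (R : realType) (f : {mpoly R[3]}) (x : 'rV[R]_3).
Hypothesis f2 : deg_le 2 f.
Let n := grad_at f x.
Let A := hess_at f x.
Let sA : A^T = A := hess_at_sym f x.

(** If m = k the second factor of the obstruction vanishes, and if k = 0 the third. Otherwise the
    relation on al, be and c can be solved for c whatever al and be are, so criticality forces p = q
    = 0 and the first factor vanishes. *)
Lemma Cr_obstruction : Cr f x -> f.@[x 0] = 0 /\
  forall a b c d e g h, obstruction n A a b c d e g h = 0.
Proof.
case=> z [cw dw] xz.
have [x' [l [u [y1 [y2 zE]]]]] := amb_point_ex z.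
have xx' : x = x' by rewrite xz zE /amb_point row_mxKl.
rewrite {xz}zE -{x'}xx' in cw dw.
move/curvature_varietyP: cw => [fx ln un uu pr]; split=> // a b c d e g h.
rewrite -/n -/A in ln un pr.
(* A unit vector, because u is a unit vector orthogonal to n and l^2 <n,n> = 1. *)
pose v := l *: cross u n.
have vv : dot v v = 1.
  by rewrite /v dotZl dotZr dot_cross_cross uu un mulrA -expr2 mul1r expr0n subr0.
have uv : dot u v = 0 by rewrite dotZr dot_crossl mulr0.
have vn : dot v n = 0 by rewrite dotC dotZr dot_crossr mulr0.
clearbody v.
have /(critical_frame f2 uu vv uv un vn ln pr) crit := dw.
have vAu := principal_v uv vn pr.
rewrite -/n -/A in crit vAu *.
have uAv : dot u (A *m v) = 0 by rewrite (dot_sym _ _ sA).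
have vu : dot v u = 0 by rewrite dotC.
have tE w : dot n w = 0 -> w = dot u w *: u + dot v w *: v.
  move=> nw; rewrite {1}(frame_expansion uu vv uv un vn ln w).
  by rewrite nw mul0r scale0r addr0.
(* On tangent vectors the second fundamental form is diag(k, m) in the frame, the metric is the
   identity, and pairing with An has coefficients p and q. *)
have ME w w' : dot n w = 0 -> dot n w' = 0 -> dot w (A *m w') =
    dot u (A *m u) * dot u w * dot u w' + dot v (A *m v) * dot v w * dot v w'.
  move=> /tE wE /tE w'E.
  rewrite {1}wE {1}w'E mulmxDr -!scalemxAr !(dotDl, dotDr, dotZl, dotZr).
  by rewrite vAu uAv; ring.
have NE w w' : dot n w = 0 -> dot n w' = 0 ->
    dot w w' = dot u w * dot u w' + dot v w * dot v w'.
  move=> /tE wE /tE w'E.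
  by rewrite {1}wE {1}w'E !(dotDl, dotDr, dotZl, dotZr) uu vv uv vu; ring.
have VE w : dot n w = 0 ->
    dot w (A *m n) = dot u w * dot u (A *m n) + dot v w * dot v (A *m n).
  by move=> /tE wE; rewrite {1}wE !(dotDl, dotZl).
have MtE y z := ME _ _ (dot_tau n y) (dot_tau n z).
have NtE y z := NE _ _ (dot_tau n y) (dot_tau n z).
have VtE y := VE _ (dot_tau n y).
rewrite /obstruction !MtE !NtE !VtE {MtE NtE VtE ME NE VE tE}.
move: (dot u (A *m u)) (dot v (A *m v)) (dot u (A *m n)) (dot v (A *m n)) crit.
move=> k m p q crit.
have [->|mk] := eqVneq m k; first by ring.
have [->|k0] := eqVneq k 0; first by ring.
have mk0 : (m - k) * dot n n != 0.
  by rewrite mulf_neq0 ?subr_eq0 // (frame_eta_neq0 ln).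
have sol al be : 3%:R * al * p + be * q = 0.
  pose ga := (al * k * q + be * m * p) / ((m - k) * dot n n).
  have hc : (m - k) * ga * dot n n = al * k * q + be * m * p.
    by rewrite mulrAC mulrC mulfVK.
  by have /eqP := crit al be ga hc; rewrite mulf_eq0 (negPf k0) => /eqP.
have -> : p = 0 by have := sol 1 0; lra.
have -> : q = 0 by have := sol 0 1; lra.
by rewrite !mulr0 addr0 !mul0r.
Qed.

(** A principal frame at a smooth point yields a point of the fibre: lambda is 1 / |n|, and y1 and
    y2 are the values forced by the principal equation. *)
Lemma Cr_of_frame (u v : 'cV[R]_3) :
  f.@[x 0] = 0 -> n != 0 -> dot u u = 1 -> dot v v = 1 -> dot u v = 0 ->
  dot u n = 0 -> dot v n = 0 -> dot v (A *m u) = 0 ->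
  (forall al be c : R, (dot v (A *m v) - dot u (A *m u)) * c * dot n n =
     al * dot u (A *m u) * dot v (A *m n) + be * dot v (A *m v) * dot u (A *m n) ->
     dot u (A *m u) * (3%:R * al * dot u (A *m n) + be * dot v (A *m n)) = 0) ->
  Cr f x.
Proof.
move=> fx n0 uu vv uv un vn vAu crit.
have e0 : 0 < dot n n.
  rewrite lt_neqAle eq_sym dotE sumr_ge0 ?andbT => [|i _]; last by rewrite -expr2 sqr_ge0.
  apply: contra n0 => /eqP s0; apply/eqP/matrixP => i j; rewrite (ord1 j) [RHS]mxE.
  have sq (k : 'I_3) : true -> 0 <= n k 0 * n k 0 by rewrite -expr2 sqr_ge0.
  by have /eqP := psumr_eq0P sq s0 (i := i) isT; rewrite mulf_eq0 orbb => /eqP.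
pose l := (Num.sqrt (dot n n))^-1.
have ln : l ^+ 2 * dot n n = 1.
  by rewrite exprVn sqr_sqrtr ?ltW // mulVf // gt_eqF.
have pr : A *m u + (- dot u (A *m u)) *: u + (- dot u (A *m n) / dot n n) *: n = 0.
  have E := frame_expansion uu vv uv un vn ln (A *m u).
  rewrite {1}E vAu scale0r addr0 (dot_sym n u sA).
  by rewrite !scaleNr mulNr scaleNr addrAC addrK subrr.
exists (amb_point x l u (- dot u (A *m u)) (- dot u (A *m n) / dot n n)); last first.
  by rewrite /amb_point row_mxKl.
split; first by apply/curvature_varietyP; split.
exact/(critical_frame f2 uu vv uv un vn ln pr).
Qed.

(* In the frame rotated by 60 degrees q^2 = 3 p^2, which makes the criticality
   equation proportional to the tangency equation al q + be p = 0. *)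
Lemma Cr_umbilic (u v : 'cV[R]_3) :
  f.@[x 0] = 0 -> n != 0 -> dot u u = 1 -> dot v v = 1 -> dot u v = 0 ->
  dot u n = 0 -> dot v n = 0 -> dot v (A *m u) = 0 ->
  dot v (A *m v) = dot u (A *m u) -> dot v (A *m n) = 0 -> Cr f x.
Proof.
move=> fx n0 uu vv uv un vn vAu vAv q0.
have uAv : dot u (A *m v) = 0 by rewrite (dot_sym _ _ sA).
have vu : dot v u = 0 by rewrite dotC.
pose s : R := Num.sqrt 3%:R.
have s3 : s ^+ 2 = 3%:R by rewrite sqr_sqrtr.
pose u' := (2%:R^-1) *: u + (s / 2%:R) *: v.
pose v' := (- s / 2%:R) *: u + (2%:R^-1) *: v.
have dE := (uu, vv, uv, vu, un, vn, vAu, uAv, vAv, q0).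
have kE : dot u' (A *m u') = dot u (A *m u).
  rewrite /u' mulmxDr -!scalemxAr !(dotDl, dotDr, dotZl, dotZr) !dE.
  rewrite (_ : _ + _ = (1 + s ^+ 2) / 4%:R * dot u (A *m u)); last by field.
  by rewrite s3; field.
have mE : dot v' (A *m v') = dot u (A *m u).
  rewrite /v' mulmxDr -!scalemxAr !(dotDl, dotDr, dotZl, dotZr) !dE.
  rewrite (_ : _ + _ = (1 + s ^+ 2) / 4%:R * dot u (A *m u)); last by field.
  by rewrite s3; field.
apply: (@Cr_of_frame u' v') => //.
- rewrite /u' !(dotDl, dotDr, dotZl, dotZr) !dE.
  rewrite (_ : _ + _ = (1 + s ^+ 2) / 4%:R); last by field.
  by rewrite s3; field.
- rewrite /v' !(dotDl, dotDr, dotZl, dotZr) !dE.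
  rewrite (_ : _ + _ = (1 + s ^+ 2) / 4%:R); last by field.
  by rewrite s3; field.
- by rewrite /u' /v' !(dotDl, dotDr, dotZl, dotZr) !dE; field.
- by rewrite /u' !(dotDl, dotZl) !dE; ring.
- by rewrite /v' !(dotDl, dotZl) !dE; ring.
- by rewrite /u' /v' mulmxDr -!scalemxAr !(dotDl, dotDr, dotZl, dotZr) !dE; field.
move=> al be c; rewrite kE mE subrr !mul0r /u' /v' !(dotDl, dotZl) !dE => h.
set k := dot u (A *m u) in h *; set r := dot u (A *m n) in h *.
(* The expression is a multiple of 3 - s^2 minus s times the right-hand side of the tangency
   relation, whose left-hand side is zero since m = k. *)
rewrite (_ : k * _ = (3%:R - s ^+ 2) / 2%:R * al * k * r -
  s * (al * k * (- s / 2%:R * r + 2%:R^-1 * 0) +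
       be * k * (2%:R^-1 * r + s / 2%:R * 0))); last by field.
by rewrite -h s3; ring.
Qed.

End CrDegree2.

(** * Diagonal quadrics *)

Section Quadric.
Variable K : comNzRingType.
Implicit Types (f : {mpoly K[3]}) (x : 'rV[K]_3).

(** Counterparts of [grad_at], [hess_at] and [quadric] over any ring, so that the same computations
    serve R and C. *)
Definition gradient f x : 'cV[K]_3 := \col_i (f^`M(i)).@[x 0].
Definition hessian f x : 'M[K]_3 := \matrix_(i, j) (f^`M(i)^`M(j)).@[x 0].
Definition diag_quadric (a : 'rV[K]_3) : {mpoly K[3]} :=
  (\sum_(i < 3) a 0 i *: 'X_i ^+ 2) - 1.

Variable a : 'rV[K]_3.

Lemma mderivXU (i j : 'I_3) : ('X_j : {mpoly K[3]})^`M(i) = (i == j)%:R%:MP.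
Proof.
rewrite mderivX mnm1E eq_sym; case: eqP => [->|_]; last by rewrite scale0r mpolyC0.
by rewrite -{1}[U_(j)%MM]add0m addmK mpolyX0 scale1r mpolyC1.
Qed.

Lemma mderiv_diag_quadric i : (diag_quadric a)^`M(i) = (2%:R * a 0 i) *: 'X_i.
Proof.
rewrite /diag_quadric -mpolyC1 mderivB mderivC subr0 raddf_sum (bigD1 i) //= big1.
  by rewrite addr0 mderivZ expr2 mderivM mderivXU eqxx mulr1 mul1r -mulr2n -scaler_nat scalerA mulrC.
by move=> j /negPf ji; rewrite mderivZ expr2 mderivM mderivXU eq_sym ji mul0r mulr0 addr0 scaler0.
Qed.

Lemma eval_diag_quadric x :
  (diag_quadric a).@[x 0] = \sum_i a 0 i * x 0 i ^+ 2 - 1.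
Proof.
rewrite /diag_quadric mevalB meval1 raddf_sum; congr (_ - _); apply: eq_bigr => i _ /=.
by rewrite mevalZ expr2 mevalM !mevalXU.
Qed.

Lemma gradient_quadric x : gradient (diag_quadric a) x = \col_i (2%:R * a 0 i * x 0 i).
Proof.
by apply/matrixP => i j; rewrite !mxE mderiv_diag_quadric mevalZ mevalXU.
Qed.

Lemma hessian_quadric x :
  hessian (diag_quadric a) x = \matrix_(i, j) (2%:R * a 0 i * (j == i)%:R).
Proof.
apply/matrixP => i j.
by rewrite !mxE mderiv_diag_quadric mderivZ mevalZ mderivXU mevalC.
Qed.

Lemma hessian_quadric_mul x (w : 'cV[K]_3) i :
  (hessian (diag_quadric a) x *m w) i 0 = 2%:R * a 0 i * w i 0.
Proof.
rewrite hessian_quadric mxE (bigD1 i) //= big1 => [|j /negPf ji]; rewrite mxE ?eqxx ?ji.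
  by rewrite mulr1 addr0.
by rewrite mulr0 mul0r.
Qed.

Lemma deg_diag_quadric : deg_le 2 (diag_quadric a).
Proof.
have le3 (p q : {mpoly K[3]}) : (msize p <= 3 -> msize q <= 3 -> msize (p + q) <= 3)%N.
  by move=> hp hq; apply: leq_trans (msizeD_le _ _) _; rewrite geq_max hp.
apply: (le3); last by rewrite msizeN msize1.
apply: (big_ind (fun p : {mpoly K[3]} => msize p <= 3)%N _ le3); first by rewrite msize0.
move=> i _; apply: leq_trans (msizeZ_le _ _) _.
by rewrite mpolyXn msizeX mdegMn mdeg1.
Qed.

End Quadric.

Definition distinct3 (i j k : 'I_3) : bool := [&& i != j, i != k & j != k].

Lemma ord3P (P : 'I_3 -> Prop) : P 0 -> P 1 -> P 2%:R -> forall i, P i.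
Proof.
move=> P0 P1 P2 [[|[|[|i]]] hi] //.
- by move: P0; congr P; apply: val_inj.
- by move: P1; congr P; apply: val_inj.
- by move: P2; congr P; apply: val_inj.
Qed.

Lemma sum_distinct3 (V : nmodType) (F : 'I_3 -> V) i j k :
  distinct3 i j k -> \sum_l F l = F i + F j + F k.
Proof.
move=> /and3P[ij ik jk].
rewrite (bigD1 i) //= (bigD1 j) 1?eq_sym //= (bigD1 k) /=; last first.
  by rewrite ![k == _]eq_sym ik jk.
rewrite big1 ?addr0 ?addrA // => l.
move: ij ik jk; elim/ord3P: i; elim/ord3P: j; elim/ord3P: k; by elim/ord3P: l.
Qed.

Lemma distinct3P i j k l : distinct3 i j k -> [|| l == i, l == j | l == k].
Proof.
by elim/ord3P: i; elim/ord3P: j; elim/ord3P: k; elim/ord3P: l.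
Qed.

(* For i != j this is the remaining index, as 0 + 1 + 2 = 0 in 'I_3. *)
Definition third (i j : 'I_3) : 'I_3 := - (i + j).

Lemma thirdE i j k : distinct3 i j k -> third i j = k.
Proof.
by elim/ord3P: i; elim/ord3P: j; elim/ord3P: k => // _; apply: val_inj.
Qed.

Lemma distinct3_third i j : i != j -> distinct3 i j (third i j).
Proof. by elim/ord3P: i; elim/ord3P: j. Qed.

Lemma distinct3_ex i : exists j k, distinct3 i j k.
Proof.
exists (i + 1), (i + 2%:R); by elim/ord3P: i.
Qed.

(** * Vertices and umbilics of a diagonal quadric *)

Section SpecialPoints.
Variables (K : numFieldType) (a : 'rV[K]_3).

(** The special points come in orbits under sign changes of the coordinates, so they are described,
    and later counted, through the squares of their coordinates. *)
Definition squares (x : 'rV[K]_3) : 'rV[K]_3 := \row_l x 0 l ^+ 2.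

Definition axis_squares (i : 'I_3) : 'rV[K]_3 :=
  \row_l if l == i then (a 0 i)^-1 else 0.

(** On the plane x_i = 0 the equation of the quadric and the umbilic condition are linear in the
    squares of the two other coordinates; this is their solution. *)
Definition umbilic_squares (i : 'I_3) : 'rV[K]_3 :=
  \row_l if l == i then 0 else
    a 0 (third i l) * (a 0 i - a 0 l) /
    (a 0 i * a 0 l * (a 0 (third i l) - a 0 l)).

Definition special_squares : seq 'rV[K]_3 :=
  [seq axis_squares i | i <- enum 'I_3] ++ [seq umbilic_squares i | i <- enum 'I_3].

Lemma tau_dot (n w : 'cV[K]_3) i j :
  dot (tau n (i, j)) w = n i 0 * w j 0 - n j 0 * w i 0.
Proof. by rewrite /tau -scaleNr dotDl !dotZl !dot_delta mulNr. Qed.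

Lemma tauE (n : 'cV[K]_3) i j l :
  tau n (i, j) l 0 = n i 0 * (l == j)%:R - n j 0 * (l == i)%:R.
Proof. by rewrite /tau !mxE !eqxx !andbT. Qed.

Hypothesis a0 : forall i, a 0 i != 0.
Hypothesis aa : forall i j, i != j -> a 0 i != a 0 j.

Section Solve.
Variable x : 'rV[K]_3.
Hypothesis ax : \sum_i a 0 i * x 0 i ^+ 2 = 1.
Let n := gradient (diag_quadric a) x.
Let A := hessian (diag_quadric a) x.

Lemma special_axis i j k : distinct3 i j k -> x 0 i = 0 -> x 0 j = 0 ->
  squares x \in special_squares.
Proof.
move=> d xi xj; rewrite mem_cat; apply/orP; left; apply/mapP.
exists k; rewrite ?mem_enum //; apply/rowP => l; rewrite !mxE.
have := ax; rewrite (sum_distinct3 _ d) xi xj expr0n !mulr0 !add0r => axk.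
have /or3P[/eqP->|/eqP->|/eqP->] := distinct3P l d; case/and3P: d => ij ik jk.
- by rewrite xi (negPf ik) expr0n.
- by rewrite xj (negPf jk) expr0n.
- by rewrite eqxx; apply: (mulfI (a0 k)); rewrite axk divff.
Qed.

(** The equation of the quadric eliminates one of the two squares from the umbilic condition,
    leaving a linear equation for the other. The roles of j and k are then exchanged. *)
Lemma special_umbilic i j k : distinct3 i j k -> x 0 i = 0 ->
  (a 0 i - a 0 k) * (a 0 j * x 0 j) ^+ 2 + (a 0 i - a 0 j) * (a 0 k * x 0 k) ^+ 2 = 0 ->
  squares x \in special_squares.
Proof.
move=> d xi hU; rewrite mem_cat; apply/orP; right; apply/mapP.
exists i; rewrite ?mem_enum //; apply/rowP => l; rewrite !mxE.
have := ax; rewrite (sum_distinct3 _ d) xi expr0n mulr0 add0r => h1.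
have d' : distinct3 i k j by case/and3P: d => *; apply/and3P; split; rewrite // eq_sym.
have /or3P[/eqP->|/eqP->|/eqP->] := distinct3P l d; rewrite ?eqxx ?xi ?expr0n //.
  rewrite (thirdE d); case/and3P: d => ij ik jk.
  rewrite eq_sym (negPf ij).
  have kj : a 0 k - a 0 j != 0 by rewrite subr_eq0 aa // eq_sym.
  apply: (mulIf (mulf_neq0 (mulf_neq0 (a0 i) (a0 j)) kj)).
  rewrite mulfVK ?mulf_neq0 //.
  have h2 : a 0 k * x 0 k ^+ 2 = 1 - a 0 j * x 0 j ^+ 2 by rewrite -h1; ring.
  apply/eqP; rewrite -subr_eq0 -oppr_eq0; apply/eqP; rewrite -[RHS]hU [in RHS]exprMn [in RHS]exprMn.
  rewrite [in RHS](_ : a 0 k ^+ 2 * x 0 k ^+ 2 = a 0 k * (1 - a 0 j * x 0 j ^+ 2)); last first.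
    by rewrite -h2; ring.
  by ring.
rewrite (thirdE d'); case/and3P: d => ij ik jk.
rewrite eq_sym (negPf ik).
have jk' : a 0 j - a 0 k != 0 by rewrite subr_eq0 aa.
apply: (mulIf (mulf_neq0 (mulf_neq0 (a0 i) (a0 k)) jk')).
rewrite mulfVK ?mulf_neq0 //.
have h2 : a 0 j * x 0 j ^+ 2 = 1 - a 0 k * x 0 k ^+ 2 by rewrite -h1; ring.
apply/eqP; rewrite -subr_eq0 -oppr_eq0; apply/eqP; rewrite -[RHS]hU [in RHS]exprMn [in RHS]exprMn.
rewrite [in RHS](_ : a 0 j ^+ 2 * x 0 j ^+ 2 = a 0 j * (1 - a 0 k * x 0 k ^+ 2)); last first.
  by rewrite -h2; ring.
by ring.
Qed.

(** Since the Gauss curvature does not vanish, either all first factors vanish, and x lies on an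
    axis, or all second factors do, and x is an umbilic in a coordinate plane. Only field arithmetic
    is involved, so complex points are covered. *)
Lemma special_of_obstruction :
  (forall b c d e g h o, obstruction n A b c d e g h o = 0) ->
  squares x \in special_squares.
Proof.
move=> obs.
have nE l : n l 0 = 2%:R * a 0 l * x 0 l by rewrite /n gradient_quadric mxE.
have AE (w : 'cV[K]_3) l : (A *m w) l 0 = 2%:R * a 0 l * w l 0 by rewrite /A hessian_quadric_mul.
have two0 : 2%:R != 0 :> K by rewrite pnatr_eq0.
have [k xk] : exists k, x 0 k != 0.
  case: (pickP (fun l => x 0 l != 0)) => [l xl|h]; first by exists l.
  move: ax; rewrite big1 => [/esym/eqP|l _]; first by rewrite oner_eq0.
  by have /negbFE/eqP -> := h l; rewrite expr0n mulr0.
have [i [j d]] : exists i j, distinct3 i j k.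
  have [i [j /and3P[ki kj ij]]] := distinct3_ex k.
  by exists i, j; apply/and3P; split; rewrite // eq_sym.
have /and3P[ij ik jk] := d.
have dE := (eqxx, negPf ij, negPf ik, negPf jk, eq_sym j i, eq_sym k i, eq_sym k j).
(* With x_k nonzero, tau(j,k) and tau(k,i) are independent. Their minor is a nonzero multiple of the
   sum of the a_l x_l^2, which is 1. *)
have W0 : dot (tau n (j, k)) (A *m tau n (j, k)) * dot (tau n (k, i)) (A *m tau n (k, i)) -
   dot (tau n (j, k)) (A *m tau n (k, i)) ^+ 2 != 0.
  rewrite !tau_dot !AE !tauE !dE !nE /=.
  rewrite (_ : _ - _ = 64%:R * (a 0 i * a 0 j * a 0 k) * (a 0 k * x 0 k) ^+ 2 *
     (a 0 i * x 0 i ^+ 2 + a 0 j * x 0 j ^+ 2 + a 0 k * x 0 k ^+ 2)); last by ring.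
  by rewrite -(sum_distinct3 (fun l => a 0 l * x 0 l ^+ 2) d) ax mulr1 !mulf_neq0 ?pnatr_eq0 ?expf_neq0 ?mulf_neq0.
have VU b c e g h : dot (tau n b) (A *m n) = 0 \/
  dot (tau n c) (A *m tau n e) * dot (tau n g) (tau n h) -
   dot (tau n g) (A *m tau n h) * dot (tau n c) (tau n e) = 0.
  have /eqP := obs b c e g h (j, k) (k, i).
  rewrite /obstruction mulf_eq0 (negPf W0) orbF mulf_eq0.
  by case/orP => /eqP; [left|right].
have neq0 (b c : K) : b * c = 0 -> b != 0 -> c = 0.
  by move=> /eqP; rewrite mulf_eq0 => /orP[->//|/eqP].
(* If An is parallel to n, the distinctness of the a_l leaves only the coordinate x_k. Otherwise
   some first factor is nonzero, which makes every second factor vanish. *)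
have [V|nV] := EM (forall b, dot (tau n b) (A *m n) = 0).
  have V2 l : l != k -> x 0 l = 0.
    move=> lk; have := V (k, l); rewrite tau_dot !AE !nE => h.
    apply: (neq0 (8%:R * (a 0 k * x 0 k) * a 0 l * (a 0 l - a 0 k))).
      by rewrite -[RHS]h; ring.
    by rewrite !mulf_neq0 ?pnatr_eq0 ?subr_eq0 ?aa.
  exact: (special_axis d (V2 _ ik) (V2 _ jk)).
have U c e g h : dot (tau n c) (A *m tau n e) * dot (tau n g) (tau n h) -
   dot (tau n g) (A *m tau n h) * dot (tau n c) (tau n e) = 0.
  by apply: contrapT => nU; apply: nV => b; have [] := VU b c e g h.
have plane p q : distinct3 p q k -> x 0 p = 0 -> squares x \in special_squares.
  move=> d' xp; have [xq|xq] := eqVneq (x 0 q) 0; first exact: (special_axis d' xp xq).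
  apply: (special_umbilic d' xp).
  have /and3P[pq pk qk] := d'.
  have dE' := (eqxx, negPf pq, negPf pk, negPf qk, eq_sym q p, eq_sym k p, eq_sym k q).
  (* For these indices and x_p = 0 the second factor is the umbilic condition times a nonzero
     number. *)
  have := U (q, k) (q, k) (k, p) (p, q).
  rewrite !tau_dot !AE !tauE !dE' !nE xp /= => h.
  apply: (neq0 (32%:R * (a 0 q * x 0 q) * (a 0 k * x 0 k))).
    by rewrite -[RHS]h; ring.
  by rewrite !mulf_neq0 ?pnatr_eq0.
(* For these indices the second factor is a nonzero multiple of x_i^2 x_j, so x lies in a coordinate
   plane. *)
have := U (j, k) (k, i) (j, k) (i, j).
rewrite !tau_dot !AE !tauE !dE !nE /= => h.
have /eqP : x 0 i ^+ 2 * x 0 j = 0.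
  apply: (neq0 (32%:R * a 0 i ^+ 2 * a 0 j * (a 0 k * x 0 k) * (a 0 k - a 0 j))).
    by rewrite -[RHS]h; ring.
  by rewrite !mulf_neq0 ?pnatr_eq0 ?expf_neq0 ?subr_eq0 ?aa // eq_sym.
rewrite mulf_eq0 expf_eq0 /=; case/orP => /eqP x0; first exact: (plane i j).
apply: (plane j i) => //; rewrite /distinct3 eq_sym ij jk ik //.
Qed.

End Solve.

Lemma squares_axisP (x : 'rV[K]_3) i : squares x = axis_squares i ->
  forall j k, distinct3 i j k -> [/\ x 0 j = 0, x 0 k = 0 & a 0 i * x 0 i ^+ 2 = 1].
Proof.
move=> /rowP sx j k /and3P[ij ik jk].
have sxl l : x 0 l ^+ 2 = if l == i then (a 0 i)^-1 else 0.
  by have := sx l; rewrite !mxE.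
have z l : l != i -> x 0 l = 0.
  by move=> /negPf li; have /eqP := sxl l; rewrite li expf_eq0 => /eqP.
by rewrite sxl eqxx divff // !z // eq_sym.
Qed.

Lemma squares_umbilicP (x : 'rV[K]_3) i : squares x = umbilic_squares i ->
  forall j k, distinct3 i j k -> [/\ x 0 i = 0,
    a 0 j * x 0 j ^+ 2 + a 0 k * x 0 k ^+ 2 = 1
  & (a 0 i - a 0 k) * (a 0 j * x 0 j) ^+ 2 + (a 0 i - a 0 j) * (a 0 k * x 0 k) ^+ 2 = 0].
Proof.
move=> /rowP sx j k d.
have d' : distinct3 i k j by case/and3P: d => *; apply/and3P; split; rewrite // eq_sym.
have sxl l : x 0 l ^+ 2 = if l == i then 0 else
    a 0 (third i l) * (a 0 i - a 0 l) / (a 0 i * a 0 l * (a 0 (third i l) - a 0 l)).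
  by have := sx l; rewrite !mxE.
have xi : x 0 i = 0 by have /eqP := sxl i; rewrite eqxx expf_eq0 => /eqP.
have := sxl k; rewrite (thirdE d'); have := sxl j; rewrite (thirdE d).
case/and3P: d => ij ik jk; rewrite ![_ == i]eq_sym (negPf ij) (negPf ik).
rewrite !exprMn => -> ->.
have h1 : a 0 k - a 0 j != 0 by rewrite subr_eq0 aa // eq_sym.
have h2 : a 0 j - a 0 k != 0 by rewrite subr_eq0 aa.
by split=> //; field; rewrite !a0 h1 h2.
Qed.

End SpecialPoints.

(** * Counting *)

Section Counting.
Variables (K : numFieldType) (rt : K -> seq K).
Hypothesis rtP : forall b y, (y \in rt b) = (y ^+ 2 == b).
Hypothesis rt_uniq : forall b, uniq (rt b).

Lemma size_rt0 : size (rt 0) = 1%N.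
Proof.
have -> : size (rt 0) = size [:: 0 : K] by
  apply/perm_size/uniq_perm => // y; rewrite rtP inE expf_eq0.
by [].
Qed.

Definition row3 (y z w : K) : 'rV[K]_3 := \row_l [:: y; z; w]`_l.

(** The fibre of [squares] over [s], listed by combining square roots. The list [rt b] of square
    roots of b is kept abstract so that real and complex points are counted together. *)
Definition points (s : 'rV[K]_3) : seq 'rV[K]_3 :=
  [seq row3 p.1 p.2.1 p.2.2 | p <- [seq (y, q) | y <- rt (s 0 0),
     q <- [seq (z, w) | z <- rt (s 0 1), w <- rt (s 0 2%:R)]]].

Lemma mem_points s x : (x \in points s) = (squares x == s).
Proof.
apply/mapP/eqP => [[_ /allpairsP[[y q] /= [hy hq ->]] ->]|<-].
  move: hq => /allpairsP[[z w] /= [hz hw ->]] /=; apply/rowP.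
  by apply: ord3P; rewrite !mxE /=; apply/eqP; rewrite -rtP.
exists (x 0 0, (x 0 1, x 0 2%:R)) => /=.
  apply/allpairsP; exists (x 0 0, (x 0 1, x 0 2%:R)); split=> //=.
    by rewrite rtP mxE.
  by apply/allpairsP; exists (x 0 1, x 0 2%:R); split=> //=; rewrite rtP mxE.
by apply/rowP; apply: ord3P; rewrite !mxE.
Qed.

Lemma size_points s : size (points s) = (\prod_l size (rt (s 0%R l)))%N.
Proof.
rewrite size_map !size_allpairs !big_ord_recl big_ord0 muln1.
by do !congr (_ * _)%N; congr (size (rt (s 0 _))); apply: val_inj.
Qed.

Lemma points_uniq s : uniq (points s).
Proof.
rewrite map_inj_uniq.
  rewrite !allpairs_uniq // => [[y q] [y' q'] _ _ /= [-> ->] //|].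
  by move=> [z w] [z' w'] _ _ /= [-> ->].
move=> [y [z w]] [y' [z' w']] /rowP e /=.
have := e 0; have := e 1; have := e 2%:R.
by rewrite !mxE /= => -> -> ->.
Qed.

(** Fibres of [squares] over distinct vectors are disjoint, so their sizes add up, and each size is
    a product of numbers of roots. *)
Lemma card_squares (S : set 'rV[K]_3) (L : seq 'rV[K]_3) :
  uniq L -> (forall x, S x <-> squares x \in L) ->
  S #= `I_(\sum_(s <- L) \prod_l size (rt (s 0%R l)))%N.
Proof.
move=> uL SL.
pose l := [seq x | s <- L, x <- points s].
have ul : uniq l.
  apply: allpairs_uniq_dep => // [s _|]; first exact: points_uniq.
  move=> p p' /allpairsPdep[s [x [_ + ->]]] /allpairsPdep[s' [x' [_ + ->]]] /= xx'.
  by rewrite -{}xx' !mem_points => /eqP -> /eqP ->.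
have sl : size l = (\sum_(s <- L) \prod_l size (rt (s 0%R l)))%N.
  rewrite /l size_allpairs_dep sumnE big_map.
  by apply: eq_bigr => s _; rewrite size_points.
have -> : S = [set` [fset x in l]%fset].
  apply/seteqP; split=> x /=; rewrite !inE.
    by move=> /SL h; apply/allpairsPdep; exists (squares x), x; rewrite h mem_points eqxx.
  by move=> /allpairsPdep[s [y [sL + ->]]]; rewrite mem_points => /eqP e; apply/SL; rewrite e.
apply/card_eq_fsetP; rewrite card_fseq undup_id //.
Qed.

Variable a : 'rV[K]_3.
Hypothesis a0 : forall i, a 0 i != 0.
Hypothesis aa : forall i j, i != j -> a 0 i != a 0 j.

Lemma umbilic_squares_neq0 i l : l != i -> umbilic_squares a i 0 l != 0.
Proof.
move=> li; rewrite mxE (negPf li).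
have d : distinct3 i l (third i l) by apply: distinct3_third; rewrite eq_sym.
have /and3P[il it lt] := d.
by rewrite !mulf_neq0 ?invr_eq0 ?mulf_neq0 ?subr_eq0 ?aa // eq_sym.
Qed.

(** An axis vector has two zero entries and an umbilic vector exactly one, so the two lists are
    disjoint; the position of the nonzero, respectively zero, entry recovers the index. *)
Lemma special_squares_uniq : uniq (special_squares a).
Proof.
rewrite cat_uniq; apply/and3P; split.
- rewrite map_inj_uniq ?enum_uniq // => i j /rowP/(_ i); rewrite !mxE eqxx.
  by case: eqP => // _ /eqP; rewrite invr_eq0 (negPf (a0 _)).
- apply/hasPn => s /mapP[i _ ->]; apply/mapP => -[j _ /rowP e].
  have [k kj ki] : exists2 k, k != j & k != i.
    by elim/ord3P: i {e}; elim/ord3P: j; (try by exists 0); (try by exists 1);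
       by exists 2%:R.
  have := umbilic_squares_neq0 ki; rewrite e mxE (negPf kj) eqxx //.
- rewrite map_inj_uniq ?enum_uniq // => i j /rowP/(_ i) e.
  apply/eqP/negPn/negP => ij; have := umbilic_squares_neq0 ij.
  by rewrite -e mxE !eqxx.
Qed.

Lemma prod_axis i :
  (\prod_l size (rt (axis_squares a i 0%R l)))%N = size (rt (a 0%R i)^-1).
Proof.
rewrite (bigD1 i) //= mxE eqxx big1 ?muln1 // => l /negPf li.
by rewrite mxE li size_rt0.
Qed.

Lemma prod_umbilic i j k : distinct3 i j k ->
  (\prod_l size (rt (umbilic_squares a i 0%R l)))%N =
  (size (rt (umbilic_squares a i 0%R j)) * size (rt (umbilic_squares a i 0%R k)))%N.
Proof.
move=> d; have /and3P[ij ik jk] := d.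
rewrite (bigD1 i) //= {1}mxE eqxx size_rt0 mul1n.
rewrite (bigD1 j) 1?eq_sym //= (bigD1 k) /=; last by rewrite ![k == _]eq_sym ik jk.
rewrite big1 ?muln1 // => l.
by have := distinct3P l d; case: (l == i); case: (l == j); case: (l == k).
Qed.

Lemma sum_special :
  (\sum_(s <- special_squares a) \prod_l size (rt (s 0%R l)) =
   \sum_i size (rt (a 0%R i)^-1) +
   \sum_i \prod_l size (rt (umbilic_squares a i 0%R l)))%N.
Proof.
rewrite big_cat !big_map -!enumT !big_enum; congr (_ + _)%N.
by apply: eq_bigr => i _; exact: prod_axis.
Qed.

End Counting.

Section Roots.

Definition real_roots (R : realType) (b : R) : seq R :=
  if b == 0 then [:: 0] else
  if 0 < b then [:: Num.sqrt b; - Num.sqrt b] else [::].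

Lemma real_rootsP (R : realType) (b y : R) : (y \in real_roots b) = (y ^+ 2 == b).
Proof.
rewrite /real_roots; have [->|b0] := eqVneq b 0; first by rewrite inE expf_eq0.
have [bp|bn] := ltP 0 b; first by rewrite !inE -eqf_sqr sqr_sqrtr // ltW.
rewrite in_nil; apply/esym/eqP => h; move: b0; rewrite -h.
by rewrite eq_le sqr_ge0 h bn.
Qed.

Lemma real_roots_uniq (R : realType) (b : R) : uniq (real_roots b).
Proof.
rewrite /real_roots; case: eqP => // _; case: ifP => //= bp.
by rewrite inE andbT eq_sym eqNr sqrtr_eq0 -ltNge.
Qed.

Lemma size_real_roots (R : realType) (b : R) : b != 0 ->
  size (real_roots b) = ((0 < b)%R * 2)%N.
Proof. by rewrite /real_roots => /negPf ->; case: ifP. Qed.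

Definition complex_roots (R : realType) (b : R[i]) : seq R[i] :=
  if b == 0 then [:: 0] else [:: sqrtC b; - sqrtC b].

Lemma complex_rootsP (R : realType) (b y : R[i]) :
  (y \in complex_roots b) = (y ^+ 2 == b).
Proof.
rewrite /complex_roots; case: eqP => [->|b0]; first by rewrite inE expf_eq0.
by rewrite !inE -eqf_sqr sqrtCK.
Qed.

Lemma complex_roots_uniq (R : realType) (b : R[i]) : uniq (complex_roots b).
Proof.
rewrite /complex_roots; case: eqP => //= /eqP b0.
by rewrite inE andbT eq_sym eqNr sqrtC_eq0.
Qed.

Lemma size_complex_roots (R : realType) (b : R[i]) : b != 0 ->
  size (complex_roots b) = 2.
Proof. by rewrite /complex_roots => /negPf ->. Qed.

End Roots.

(** Two points on each of three axes and four in each of three coordinate planes: 3 * 2 + 3 * 4. *)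
Lemma sum_special_complex (R : realType) (a : 'rV[R[i]]_3) :
  (forall i, a 0 i != 0) -> (forall i j, i != j -> a 0 i != a 0 j) ->
  (\sum_(s <- special_squares a) \prod_l size (complex_roots (s 0%R l)) = 18)%N.
Proof.
move=> a0 aa; rewrite (sum_special (@complex_rootsP R) (@complex_roots_uniq R)).
rewrite (eq_bigr (fun _ => 2%N)) => [|i _]; last by rewrite size_complex_roots ?invr_eq0.
rewrite [X in (_ + X)%N](eq_bigr (fun _ => 4%N)) => [|i _].
  by rewrite !sum_nat_const card_ord.
have [j [k d]] := distinct3_ex i.
rewrite (prod_umbilic (@complex_rootsP R) (@complex_roots_uniq R) _ d).
have /and3P[ij ik jk] := d.
by rewrite !size_complex_roots ?umbilic_squares_neq0 // eq_sym.
Qed.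

(** Boolean equality plays the role of multiplication of signs. Accordingly [P] below says that the
    product of the three coefficients is positive. *)
Lemma gt0_mul (R : realDomainType) (x y : R) : x != 0 -> y != 0 ->
  (0 < x * y) = ((0 < x) == (0 < y)).
Proof.
move=> x0 y0; case: (ltrgt0P x) x0 => // hx _.
  by rewrite pmulr_rgt0 //; case: (0 < y).
by rewrite nmulr_rgt0 //; case: (ltrgt0P y) y0.
Qed.

Section RealCount.
Variables (R : realType) (a : 'rV[R]_3).
Hypothesis a0 : forall i, a 0 i != 0.
Hypothesis aa : forall i j, i != j -> a 0 i != a 0 j.
Let pos i := (0 < a 0 i).
Let P := (pos 0 == pos 1) == pos 2%:R.

(** The quotient has the sign of a_i a_j a_k (a_i - a_j) (a_k - a_j). *)
Lemma umbilic_gt0 i j k : distinct3 i j k ->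
  (0 < umbilic_squares a i 0 j) = ((P == (a 0 j < a 0 i)) == (a 0 j < a 0 k)).
Proof.
move=> d; have /and3P[ij ik jk] := d.
rewrite mxE eq_sym (negPf ij) (thirdE d).
have d1 : a 0 i - a 0 j != 0 by rewrite subr_eq0 aa.
have d2 : a 0 k - a 0 j != 0 by rewrite subr_eq0 aa // eq_sym.
rewrite !gt0_mul ?mulf_neq0 ?invr_eq0 ?mulf_neq0 // invr_gt0 !gt0_mul ?mulf_neq0 //.
rewrite !subr_gt0 -![0 < a 0 _]/(pos _).
have -> : P = ((pos i == pos j) == pos k).
  rewrite /P; elim/ord3P: i d {ij ik d1}; elim/ord3P: j {jk d2}; elim/ord3P: k => //= _;
  by case: (pos 0); case: (pos 1); case: (pos 2%:R).
by case: (pos i); case: (pos j); case: (pos k); case: (_ < _); case: (_ < _).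
Qed.

(** An axis carries two real points when its coefficient is positive. The umbilics with x_i = 0 are
    real when both squares are positive. If [P] holds, this says that neither a_j nor a_k lies
    between the other two coefficients, so a_i is the middle one and exactly one plane contributes 4
    points. If [P] fails, a_j and a_k would both have to be the middle one, which is impossible. *)
Lemma sum_special_real :
  (\sum_(s <- special_squares a) \prod_l size (real_roots (s 0%R l)) =
   (pos 0%R + pos 1%R + pos 2%:R) * 2 + P * 4)%N.
Proof.
rewrite (sum_special (@real_rootsP R) (@real_roots_uniq R)); congr (_ + _)%N.
  rewrite (eq_bigr (fun i => pos i * 2)%N) => [|i _]; last first.
    by rewrite size_real_roots ?invr_eq0 // invr_gt0.
  by rewrite sum3 !mulnDl.
pose lt i j := a 0 i < a 0 j.
have E i j k : distinct3 i j k ->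
    (\prod_l size (real_roots (umbilic_squares a i 0%R l)))%N =
    ((((P == lt j i) == lt j k) && ((P == lt k i) == lt k j)) * 4)%N.
  move=> d; have d' : distinct3 i k j.
    by case/and3P: d => *; apply/and3P; split; rewrite // eq_sym.
  rewrite (prod_umbilic (@real_rootsP R) (@real_roots_uniq R) _ d).
  have /and3P[ij ik jk] := d.
  rewrite !size_real_roots ?umbilic_squares_neq0 // 1?[_ == i]eq_sym //.
  rewrite (umbilic_gt0 d) (umbilic_gt0 d') /lt.
  by case: ((P == _) == _); case: ((P == _) == _).
rewrite sum3 (E 0 1 2%:R) // (E 1 0 2%:R) // (E 2%:R 0 1) //.
have ltN i j : i != j -> lt j i = ~~ lt i j.
  by move=> ij; rewrite /lt -leNgt le_eqVlt eq_sym (negPf (aa ij)).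
rewrite (ltN 0 1) // (ltN 0 2%:R) // (ltN 1 2%:R) //.
(* Transitivity excludes the two cyclic patterns of comparisons; the remaining truth values are
   checked one by one. *)
have t1 : lt 0 1 -> lt 1 2%:R -> lt 0 2%:R by exact: lt_trans.
have t2 : ~~ lt 0 1 -> ~~ lt 1 2%:R -> ~~ lt 0 2%:R.
  by rewrite -!ltN // /lt => h1 h2; exact: lt_trans h2 h1.
move: t1 t2; case: (lt 0 1); case: (lt 1 2%:R); case: (lt 0 2%:R); case: (P) => //=.
all: by move=> *; intuition.
Qed.

Lemma num_posE : num_pos a = (pos 0%R + pos 1%R + pos 2%:R)%N.
Proof.
by rewrite /num_pos -sum1_card big_mkcond sum3 !inE -![0 < a 0 _]/(pos _);
  case: (pos 0); case: (pos 1); case: (pos 2%:R).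
Qed.

Lemma num_negE : num_neg a = (~~ pos 0%R + ~~ pos 1%R + ~~ pos 2%:R)%N.
Proof.
have E i : (a 0 i < 0) = ~~ pos i by rewrite /pos -leNgt le_eqVlt (negPf (a0 i)).
rewrite /num_neg -sum1_card big_mkcond sum3 !inE !E.
by case: (pos 0); case: (pos 1); case: (pos 2%:R).
Qed.

End RealCount.

(** * Real and complex critical curvature points *)

(** At a vertex An is normal, so in the frame of the two other coordinate vectors p = q = 0 and
    criticality is immediate. *)
Lemma Cr_axis (R : realType) (a x : 'rV[R]_3) i j k : distinct3 i j k ->
  x 0 j = 0 -> x 0 k = 0 -> a 0 i * x 0 i ^+ 2 = 1 -> Cr (quadric a) x.
Proof.
move=> d xj xk axi; have /and3P[ij ik jk] := d.
have gE l : grad_at (quadric a) x l 0 = 2%:R * a 0 l * x 0 l.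
  by rewrite (gradient_quadric a x : grad_at (quadric a) x = _) mxE.
have hE (w : 'cV[R]_3) l : (hess_at (quadric a) x *m w) l 0 = 2%:R * a 0 l * w l 0.
  exact: hessian_quadric_mul.
apply: (@Cr_of_frame _ _ _ (deg_diag_quadric a) (delta_mx j 0) (delta_mx k 0));
  rewrite ?dot_delta ?hE ?gE ?xj ?xk ?mulr0 ?[delta_mx _ _ _ _]mxE ?eqxx //.
- rewrite eval_diag_quadric (sum_distinct3 _ d) xj xk axi expr0n !mulr0 !addr0.
  by rewrite subrr.
- apply: contra_eq_neq axi => /(congr1 (fun M : 'cV[R]_3 => M i 0)); rewrite gE mxE => h.
  have -> : a 0 i * x 0 i ^+ 2 = 2%:R^-1 * (2%:R * a 0 i * x 0 i) * x 0 i by field.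
  by rewrite h mulr0 mul0r eq_sym oner_neq0.
- by rewrite (negPf jk).
- by rewrite eq_sym (negPf jk) mulr0.
- by move=> *; rewrite !mulr0 addr0 mulr0.
Qed.

(** The frame consists of the unit tangent vector in the plane x_i = 0 and of e_i. As n has no
    i-component, neither has An, so q = 0; the last hypothesis is the equality m = k. *)
Lemma Cr_umbilic_quadric (R : realType) (a x : 'rV[R]_3) i j k :
  distinct3 i j k -> x 0 i = 0 -> a 0 j * x 0 j ^+ 2 + a 0 k * x 0 k ^+ 2 = 1 ->
  (a 0 i - a 0 k) * (a 0 j * x 0 j) ^+ 2 +
    (a 0 i - a 0 j) * (a 0 k * x 0 k) ^+ 2 = 0 ->
  Cr (quadric a) x.
Proof.
move=> d xi ax hU; have /and3P[ij ik jk] := d.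
have dE := (eqxx, negPf ij, negPf ik, negPf jk, eq_sym j i, eq_sym k i, eq_sym k j).
have gE l : grad_at (quadric a) x l 0 = 2%:R * a 0 l * x 0 l.
  by rewrite (gradient_quadric a x : grad_at (quadric a) x = _) mxE.
have hE (w : 'cV[R]_3) l : (hess_at (quadric a) x *m w) l 0 = 2%:R * a 0 l * w l 0.
  exact: hessian_quadric_mul.
have fx : (quadric a).@[x 0] = 0.
  by rewrite eval_diag_quadric (sum_distinct3 _ d) xi expr0n mulr0 add0r ax subrr.
pose e := (a 0 j * x 0 j) ^+ 2 + (a 0 k * x 0 k) ^+ 2.
have e0 : 0 < e.
  rewrite lt_neqAle addr_ge0 ?sqr_ge0 // andbT eq_sym.
  rewrite paddr_eq0 ?sqr_ge0 // !expf_eq0 /=; apply/negP => /andP[/eqP hj /eqP hk].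
  by move/eqP: ax; rewrite !expr2 !mulrA hj hk !mul0r addr0 eq_sym oner_eq0.
pose la := (2%:R * Num.sqrt e)^-1.
(* The squared length of tau(j,k) is 4 [e], so [la] normalises it. *)
have le : 4%:R * la ^+ 2 * e = 1.
  rewrite /la exprVn exprMn sqr_sqrtr ?ltW // -natrX; field.
  by rewrite gt_eqF.
have n0 : grad_at (quadric a) x != 0.
  apply: contraTneq e0 => /matrixP h; rewrite -leNgt.
  have {h}h l : a 0 l * x 0 l = 0.
    have := h l 0; rewrite gE mxE -mulrA => /eqP.
    by rewrite mulf_eq0 pnatr_eq0 => /eqP.
  by rewrite /e !h expr0n addr0.
pose n := grad_at (quadric a) x.
apply: (@Cr_umbilic _ _ _ (deg_diag_quadric a) (la *: tau n (j, k)) (delta_mx i 0)) => //;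
  rewrite ?dot_delta ?hE ?gE ?xi ?mulr0 //.
- rewrite dotZl dotZr tau_dot !tauE !dE /n !gE /= -[RHS]le /e; ring.
- by rewrite mxE !eqxx.
- by rewrite dotC dot_delta mxE tauE !dE /= !mulr0 subrr mulr0.
- by rewrite dotZl dotC dot_tau mulr0.
- by rewrite mxE tauE !dE /= !mulr0 subrr !mulr0.
rewrite [delta_mx _ _ _ _]mxE !eqxx mulr1.
rewrite -scalemxAr dotZl dotZr tau_dot !hE !tauE !dE /n !gE /=.
apply/eqP; rewrite -subr_eq0; apply/eqP.
(* Multiplying by 1 makes both sides proportional to [la ^+ 2]; their difference is then a multiple
   of the umbilic condition. *)
have -> : 2%:R * a 0 i = 2%:R * a 0 i * (4%:R * la ^+ 2 * e) by rewrite le mulr1.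
transitivity (8%:R * la ^+ 2 * ((a 0 i - a 0 k) * (a 0 j * x 0 j) ^+ 2 +
    (a 0 i - a 0 j) * (a 0 k * x 0 k) ^+ 2)); last by rewrite hU mulr0.
by rewrite /e; ring.
Qed.

Lemma Cr_quadricP (R : realType) (a x : 'rV[R]_3) :
  (forall i, a 0 i != 0) -> (forall i j, i != j -> a 0 i != a 0 j) ->
  Cr (quadric a) x <-> squares x \in special_squares a.
Proof.
move=> a0 aa; split=> [/(Cr_obstruction (deg_diag_quadric a))[]|].
  rewrite eval_diag_quadric => /eqP; rewrite subr_eq0 => /eqP ax.
  exact: special_of_obstruction.
rewrite mem_cat => /orP[] /mapP[i _ h]; have [j [k d]] := distinct3_ex i.
  have [xj xk axi] := squares_axisP a0 h d.
  exact: Cr_axis d xj xk axi.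
have [xi ax hU] := squares_umbilicP a0 aa h d.
exact: Cr_umbilic_quadric d xi ax hU.
Qed.

(** * Upper bound: the obstructions as polynomials on the space of pairs (f, x) *)

Section Lift.
Variable K : fieldType.
Local Notation N := #|{: 'X_{1..3 < 3}}|.

(* The polynomial in the coordinates of a pair (f, x) whose value is T f at x,
   for T linear. *)
Definition lift_linear (T : {mpoly K[3]} -> {mpoly K[3]}) : {mpoly K[N + 3]} :=
  \sum_(j < N) 'X_(lshift 3 j) *
    (T 'X_[(enum_val j : 'X_{1..3 < 3})] \mPo [tuple 'X_(rshift N i) | i < 3]).

Lemma eval_lift_linear (T : {linear {mpoly K[3]} -> {mpoly K[3]}}) f x :
  deg_le 2 f -> (lift_linear T).@[pair_coords f x 0] = (T f).@[x 0].
Proof.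
move=> f2; rewrite {2}(mpolywE f2) raddf_sum raddf_sum /lift_linear raddf_sum /=.
rewrite [RHS](eq_bigl (mem {: 'X_{1..3 < 3}})) // [RHS]big_enum_val.
apply: eq_bigr => j _ /=.
rewrite linearZ mevalZ mevalM mevalXU /pair_coords row_mxEl mxE; congr (_ * _).
rewrite comp_mpoly_meval; apply: meval_eq => i.
by rewrite tnth_map tnth_ord_tuple mevalXU row_mxEr.
Qed.

Definition lift_gradient : 'cV[{mpoly K[N + 3]}]_3 :=
  \col_i lift_linear (mderiv i).

Definition lift_hessian : 'M[{mpoly K[N + 3]}]_3 :=
  \matrix_(i, j) lift_linear (mderiv j \o mderiv i).

Lemma eval_lift_gradient f x : deg_le 2 f ->
  map_mx (meval (pair_coords f x 0)) lift_gradient = gradient f x.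
Proof.
by move=> f2; apply/matrixP => i j; rewrite !mxE; apply: eval_lift_linear.
Qed.

Lemma eval_lift_hessian f x : deg_le 2 f ->
  map_mx (meval (pair_coords f x 0)) lift_hessian = hessian f x.
Proof.
move=> f2; apply/matrixP => i j; rewrite !mxE.
exact: (eval_lift_linear (mderiv j \o mderiv i : {linear _ -> _}) x f2).
Qed.

Definition obstruction_poly (a b c d e g h : 'I_3 * 'I_3) : {mpoly K[N + 3]} :=
  obstruction lift_gradient lift_hessian a b c d e g h.

Lemma eval_obstruction_poly a b c d e g h f x : deg_le 2 f ->
  (obstruction_poly a b c d e g h).@[pair_coords f x 0] =
  obstruction (gradient f x) (hessian f x) a b c d e g h.
Proof.
move=> f2; rewrite -(eval_lift_gradient x f2) -(eval_lift_hessian x f2).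
exact: rmorph_obstruction.
Qed.

End Lift.

Section Complexify.
Variable R : realType.
Implicit Types (f : {mpoly R[3]}) (x : 'rV[R]_3).
Local Notation rc := (real_complex R).

Lemma deg_complexify f : deg_le 2 f -> deg_le 2 (complexify f).
Proof.
move=> f2; rewrite /deg_le msizeE; apply/bigmax_leqP_seq => m + _.
rewrite mcoeff_msupp mcoeff_map_mpoly => fm.
apply: leq_trans (msize_mdeg_lt _) f2.
by rewrite mcoeff_msupp; apply: contraNneq fm => ->; rewrite raddf0.
Qed.

Lemma meval_complexify f x : (complexify f).@[map_mx rc x 0] = rc f.@[x 0].
Proof.
elim/mpoly_ring_ind: f => [c|i|g h Hg Hh|g h Hg Hh].
- by rewrite /complexify map_mpolyC !mevalC.
- by rewrite /complexify map_mpolyX !mevalXU mxE.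
- by rewrite /complexify raddfD /= !mevalD rmorphD /= -Hg -Hh.
- by rewrite /complexify rmorphM /= !mevalM rmorphM /= -Hg -Hh.
Qed.

Lemma mderiv_complexify f i : (complexify f)^`M(i) = complexify f^`M(i).
Proof.
apply/mpolyP => m.
by rewrite mcoeff_mderiv !mcoeff_map_mpoly mcoeff_mderiv raddfMn.
Qed.

Lemma gradient_complexify f x :
  gradient (complexify f) (map_mx rc x) = map_mx rc (gradient f x).
Proof.
by apply/matrixP => i j; rewrite !mxE mderiv_complexify meval_complexify.
Qed.

Lemma hessian_complexify f x :
  hessian (complexify f) (map_mx rc x) = map_mx rc (hessian f x).
Proof.
by apply/matrixP => i j; rewrite !mxE !mderiv_complexify meval_complexify.
Qed.

Lemma complexify_quadric (a : 'rV[R]_3) :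
  complexify (quadric a) = diag_quadric (map_mx rc a).
Proof.
rewrite /complexify /quadric rmorphB rmorph1 rmorph_sum; congr (_ - _).
by apply: eq_bigr => i _ /=; rewrite map_mpolyZ rmorphXn /= map_mpolyX mxE.
Qed.

(** If all partial derivatives 2 a_i x_i vanish, then so does each a_i x_i^2, and the polynomial
    takes the value -1. *)
Lemma nonsingular_quadric (a : 'rV[R]_3) : nonsingular (quadric a).
Proof.
rewrite /nonsingular complexify_quadric => -[x [+ gx]].
rewrite eval_diag_quadric big1 => [/eqP|i _].
  by rewrite sub0r oppr_eq0 oner_eq0.
have := gx i; rewrite mderiv_diag_quadric mevalZ mevalXU -mulrA => /eqP.
by rewrite mulf_eq0 pnatr_eq0 /= expr2 mulrA => /eqP ->; rewrite mul0r.
Qed.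

(** The value f(x) and the obstructions are polynomials in (f, x) vanishing on [Cr32], hence on its
    closure; over C they are then solved as over R. *)
Lemma complex_Cr_special (a : 'rV[R]_3) (x : 'rV[R[i]]_3) :
  (forall i, a 0 i != 0) -> (forall i j, i != j -> a 0 i != a 0 j) ->
  complex_Cr (quadric a) x -> squares x \in special_squares (map_mx rc a).
Proof.
move=> a0 aa cl.
have a2 := deg_complexify (deg_diag_quadric a : deg_le 2 (quadric a)).
apply: special_of_obstruction.
- by move=> i; rewrite mxE fmorph_eq0.
- by move=> i j ij; rewrite !mxE (inj_eq (fmorph_inj _)) aa.
- have := cl (lift_linear id) _.
  rewrite (eval_lift_linear idfun x a2) complexify_quadric eval_diag_quadric.
  move=> h; apply/eqP; rewrite -subr_eq0; apply/eqP/h => s [f [y [f2 _ cy ->]]].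
  rewrite (eval_lift_linear idfun _ (deg_complexify f2)) meval_complexify.
  by have [-> _] := Cr_obstruction f2 cy; rewrite rmorph0.
- move=> b c d e g h o; rewrite -complexify_quadric -(eval_obstruction_poly _ _ _ _ _ _ _ _ a2).
  apply: cl => s [f [y [f2 _ cy ->]]].
  rewrite (eval_obstruction_poly _ _ _ _ _ _ _ _ (deg_complexify f2)).
  rewrite gradient_complexify hessian_complexify -rmorph_obstruction.
  by have [_ ob] := Cr_obstruction f2 cy; rewrite [obstruction _ _ _ _ _ _ _ _ _]ob rmorph0.
Qed.

End Complexify.

(** * Lower bound: rational curves whose real points lie in a given set *)

Section RationalCurves.
Variables (R : realType) (d : {poly R[i]}).
Implicit Types g h : R[i] -> R[i].

(** Membership in C[t, 1/d], read as functions away from the zeros of [d]. *)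
Definition regular g := exists n (q : {poly R[i]}),
  forall t, d.[t] != 0 -> q.[t] = d.[t] ^+ n * g t.

Lemma regularC c : regular (fun=> c).
Proof. by exists 0, c%:P => t _; rewrite hornerC mul1r. Qed.

Lemma regularD g h : regular g -> regular h -> regular (fun t => g t + h t).
Proof.
move=> [n [q hq]] [m [r hr]]; exists (n + m)%N, (d ^+ m * q + d ^+ n * r) => t dt.
by rewrite hornerD !hornerM !horner_exp hq // hr // exprD; ring.
Qed.

Lemma regularM g h : regular g -> regular h -> regular (fun t => g t * h t).
Proof.
move=> [n [q hq]] [m [r hr]]; exists (n + m)%N, (q * r) => t dt.
by rewrite hornerM hq // hr // exprD; ring.
Qed.

Lemma regular_poly (p : {poly R[i]}) : regular (fun t => p.[t]).
Proof. by exists 0, p => t _; rewrite mul1r. Qed.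

Lemma regular_frac (p q e : {poly R[i]}) : d = q * e ->
  regular (fun t => p.[t] / q.[t]).
Proof.
move=> de; exists 1%N, (p * e) => t; rewrite de !hornerM mulf_eq0 negb_or => /andP[q0 _].
by field.
Qed.

Lemma regular_eq g h : g =1 h -> regular g -> regular h.
Proof. by move=> gh [n [q hq]]; exists n, q => t dt; rewrite -gh hq. Qed.

Lemma regular_meval m (c : R[i] -> 'rV[R[i]]_m) (h : {mpoly R[i][m]}) :
  (forall l, regular (fun t => c t 0 l)) -> regular (fun t => h.@[c t 0]).
Proof.
move=> rc; elim/mpoly_ring_ind: h => [k|l|g h rg rh|g h rg rh].
- by apply: regular_eq (regularC k) => t; rewrite mevalC.
- by apply: regular_eq (rc l) => t; rewrite mevalXU.
- by apply: regular_eq (regularD rg rh) => t; rewrite mevalD.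
- by apply: regular_eq (regularM rg rh) => t; rewrite mevalM.
Qed.

Lemma poly_eq0_on_reals (p : {poly R[i]}) :
  (forall t : R, p.[real_complex R t] = 0) -> p = 0.
Proof.
move=> h; pose rs := [seq (k%:R : R[i]) | k <- iota 0 (size p)].
apply: (@roots_geq_poly_eq0 _ p rs).
- by apply/allP => _ /mapP[k _ ->]; rewrite rootE -(rmorph_nat (real_complex R)) h.
- by rewrite map_inj_uniq ?iota_uniq // => k l /eqP; rewrite eqr_nat => /eqP.
- by rewrite size_map size_iota.
Qed.

(** Along the curve, a polynomial vanishing on S becomes, after multiplication by a power of [d], a
    polynomial in t. Multiplying once more by [d] makes it vanish at every real t, so it is zero,
    also at the complex parameter t0. *)
Lemma zariski_closure_curve m (S : set 'rV[R[i]]_m) (c : R[i] -> 'rV[R[i]]_m) t0 :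
  (forall l, regular (fun t => c t 0 l)) ->
  (forall t : R, d.[real_complex R t] != 0 -> S (c (real_complex R t))) ->
  d.[t0] != 0 -> zariski_closure S (c t0).
Proof.
move=> rc Sc dt0 h hS.
have [n [q hq]] := regular_meval h rc.
have d0 : d != 0 by apply: contraNneq dt0 => ->; rewrite horner0.
have /eqP : q * d = 0.
  apply: poly_eq0_on_reals => t; rewrite hornerM.
  have [->|dt] := eqVneq d.[real_complex R t] 0; first by rewrite mulr0.
  by rewrite hq // hS ?mulr0 ?mul0r //; exact: Sc.
rewrite mulf_eq0 (negPf d0) orbF => /eqP q0.
have /esym/eqP := hq _ dt0.
by rewrite q0 horner0 mulf_eq0 expf_eq0 (negPf dt0) andbF => /eqP.
Qed.

Lemma regular_pair_coords (al xi : R[i] -> 'rV[R[i]]_3) :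
  (forall l, regular (fun t => al t 0 l)) ->
  (forall l, regular (fun t => xi t 0 l)) ->
  forall l, regular (fun t => pair_coords (diag_quadric (al t)) (xi t) 0 l).
Proof.
move=> ra rx l; case: (splitP l) => [j lj|j lj].
  have {lj}-> : l = lshift 3 j by apply: val_inj.
  set m := enum_val j : 'X_{1..3 < 3}.
  apply: (@regular_eq (fun t => (al t 0 0 * ('X_0 ^+ 2)@_m +
     al t 0 1 * ('X_1 ^+ 2)@_m + al t 0 2%:R * ('X_(2%:R) ^+ 2)@_m) + (- 1)@_m)).
    move=> t; rewrite /pair_coords row_mxEl mxE /diag_quadric mcoeffD raddf_sum sum3 /=.
    by rewrite !mcoeffZ.
  by do ![exact: regularC | apply: regularD | apply: regularM].
have {lj}-> : l = rshift #|{: 'X_{1..3 < 3}}| j by apply: val_inj.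
by apply: regular_eq (rx j) => t; rewrite /pair_coords row_mxEr.
Qed.

End RationalCurves.

Lemma zariski_closure_idem (K : fieldType) n (S : set 'rV[K]_n) z :
  zariski_closure (zariski_closure S) z -> zariski_closure S z.
Proof. by move=> cl h hS; apply: cl => s; apply. Qed.

Section LowerBound.
Variable R : realType.
Local Notation rc := (real_complex R).

Lemma Cr32_quadric (a x : 'rV[R]_3) (al xi : 'rV[R[i]]_3) :
  Cr (quadric a) x -> al = map_mx rc a -> xi = map_mx rc x ->
  @Cr32 R (pair_coords (diag_quadric al) xi).
Proof.
move=> cx -> ->; exists (quadric a), x; split=> //.
- exact: deg_diag_quadric.
- exact: nonsingular_quadric.
- by rewrite complexify_quadric.
Qed.

(** The family a_i = t^-2, x_i = t consists of real vertices for real t and passes through the given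
    pair at t = x_i, which may be imaginary. *)
Lemma complex_Cr_axis (a : 'rV[R]_3) (x : 'rV[R[i]]_3) i j k :
  distinct3 i j k -> x 0 j = 0 -> x 0 k = 0 -> rc (a 0 i) * x 0 i ^+ 2 = 1 ->
  complex_Cr (quadric a) x.
Proof.
move=> d xj xk axi; rewrite /complex_Cr /= complexify_quadric.
pose al (t : R[i]) : 'rV[R[i]]_3 := \row_l if l == i then (t ^+ 2)^-1 else rc (a 0 l).
pose xi (t : R[i]) : 'rV[R[i]]_3 := \row_l if l == i then t else 0.
have xi0 : x 0 i != 0.
  by apply: contra_eq_neq axi => ->; rewrite expr0n mulr0 eq_sym oner_neq0.
have aE : map_mx rc a = al (x 0 i).
  apply/rowP => l; rewrite !mxE; case: eqP => // ->.
  by apply: (mulIf (expf_neq0 2 xi0)); rewrite axi mulVf // expf_neq0.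
have xE : x = xi (x 0 i).
  apply/rowP => l; rewrite mxE.
  by have /or3P[/eqP->|/eqP->|/eqP->] := distinct3P l d; rewrite ?eqxx //;
    case: eqP => // ->.
rewrite aE [X in pair_coords _ X]xE.
apply: (@zariski_closure_curve _ ('X ^+ 2) _ _
  (fun t => pair_coords (diag_quadric (al t)) (xi t)) (x 0 i)).
- apply: regular_pair_coords => l.
    have [li|li] := eqVneq l i; last first.
      by apply: regular_eq (regularC _ (rc (a 0 l))) => t; rewrite mxE (negPf li).
    apply: regular_eq (@regular_frac _ ('X ^+ 2) 1 ('X ^+ 2) 1 _) => [t|]; last by rewrite mulr1.
    by rewrite mxE li eqxx hornerXn hornerC mul1r.
  have [li|li] := eqVneq l i.
    by apply: regular_eq (regular_poly _ 'X) => t; rewrite mxE li eqxx hornerX.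
  by apply: regular_eq (regularC _ 0) => t; rewrite mxE (negPf li).
- move=> t; rewrite hornerXn expf_eq0 /= fmorph_eq0 => t0.
  have /and3P[ij ik _] := d.
  apply: (@Cr32_quadric (\row_l if l == i then (t ^+ 2)^-1 else a 0 l)
      (\row_l if l == i then t else 0)).
  + apply: (Cr_axis d); rewrite !mxE ?eqxx //.
    * by rewrite eq_sym (negPf ij).
    * by rewrite eq_sym (negPf ik).
    * by rewrite mulVf // expf_neq0.
  + by apply/rowP => l; rewrite !mxE; case: eqP => // _; rewrite fmorphV rmorphXn.
  + by apply/rowP => l; rewrite !mxE; case: eqP => // _; rewrite rmorph0.
- by rewrite hornerXn expf_neq0.
Qed.

Section UmbilicFamily.
Variables (i j k : 'I_3) (dijk : distinct3 i j k) (b : R).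

(** The umbilic condition gives a_i = b a_k / (b^2 y^2 + a_k^2 z^2); this is the denominator times
    z^2, with a_k z^2 = 1 - b y^2 substituted. *)
Definition umb_den (K : fieldType) (b y z : K) : K :=
  b ^+ 2 * y ^+ 2 * z ^+ 2 + (1 - b * y ^+ 2) ^+ 2.
(* The coefficients of the only quadric with a_j = b of which the point (0, y, z),
   in the order i, j, k of the axes, is an umbilic. *)
Definition umb_coef (K : fieldType) (b y z : K) : 'rV[K]_3 :=
  \row_l if l == i then b * (1 - b * y ^+ 2) / umb_den b y z else
         if l == j then b else (1 - b * y ^+ 2) / z ^+ 2.
Definition umb_point (K : fieldType) (y z : K) : 'rV[K]_3 :=
  \row_l if l == i then 0 else if l == j then y else z.
Definition umb_pair (K : fieldType) (b y z : K) :=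
  pair_coords (diag_quadric (umb_coef b y z)) (umb_point y z).

Lemma rmorph_umb_den (K L : fieldType) (phi : {rmorphism K -> L}) c y z :
  phi (umb_den c y z) = umb_den (phi c) (phi y) (phi z).
Proof. by rewrite /umb_den !(rmorphB, rmorphD, rmorphXn, rmorphM, rmorph1). Qed.

Lemma Cr_umb (y z : R) : z ^+ 2 * umb_den b y z != 0 ->
  Cr (quadric (umb_coef b y z)) (umb_point y z).
Proof.
rewrite mulf_eq0 expf_eq0 /= negb_or => /andP[z0 e0].
have /and3P[ij ik jk] := dijk.
have dE := (eqxx, negPf ij, negPf ik, negPf jk, eq_sym j i, eq_sym k i, eq_sym k j).
apply: (Cr_umbilic_quadric dijk); rewrite !mxE !dE //; first by field.
by rewrite /umb_den in e0 *; field; rewrite z0 !exprMn e0.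
Qed.

Lemma closure_umb_real (y : R) (z : R[i]) :
  z ^+ 2 * umb_den (rc b) (rc y) z != 0 ->
  zariski_closure (@Cr32 R) (umb_pair (rc b) (rc y) z).
Proof.
move=> h.
(* [umb_den] as a polynomial in z; z^2 times it is the common denominator of the family. *)
pose e : {poly R[i]} := (rc b ^+ 2 * rc y ^+ 2)%:P * 'X ^+ 2 + ((1 - rc b * rc y ^+ 2) ^+ 2)%:P.
have eE t : e.[t] = umb_den (rc b) (rc y) t.
  by rewrite /e hornerD hornerCM hornerXn hornerC.
apply: (@zariski_closure_curve _ ('X ^+ 2 * e) _ _ (fun t => umb_pair (rc b) (rc y) t) z).
- apply: regular_pair_coords => l.
    have [li|li] := eqVneq l i.
      apply: regular_eq (@regular_frac _ ('X ^+ 2 * e) (rc b * (1 - rc b * rc y ^+ 2))%:P e ('X ^+ 2) _) => [t|].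
        by rewrite mxE li eqxx hornerC eE.
      by rewrite mulrC.
    have [lj|lj] := eqVneq l j.
      by apply: regular_eq (regularC _ (rc b)) => t; rewrite mxE (negPf li) lj eqxx.
    apply: regular_eq (@regular_frac _ ('X ^+ 2 * e) (1 - rc b * rc y ^+ 2)%:P ('X ^+ 2) e _) => [t|//].
    by rewrite mxE (negPf li) (negPf lj) hornerC hornerXn.
  have [li|li] := eqVneq l i.
    by apply: regular_eq (regularC _ 0) => t; rewrite mxE li eqxx.
  have [lj|lj] := eqVneq l j.
    by apply: regular_eq (regularC _ (rc y)) => t; rewrite mxE (negPf li) lj eqxx.
  by apply: regular_eq (regular_poly _ 'X) => t; rewrite mxE (negPf li) (negPf lj) hornerX.
- move=> t; rewrite hornerM hornerXn eE => ht.
  apply: (@Cr32_quadric (umb_coef b y t) (umb_point y t)).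
  + apply: Cr_umb; rewrite -(fmorph_eq0 rc).
    by rewrite rmorphM rmorphXn rmorph_umb_den.
  + apply/rowP => l; rewrite !mxE; case: eqP => // _; last case: eqP => // _.
      by rewrite fmorph_div rmorph_umb_den !(rmorphB, rmorphXn, rmorphM, rmorph1).
    by rewrite fmorph_div !(rmorphB, rmorphXn, rmorphM, rmorph1).
  + by apply/rowP => l; rewrite !mxE; case: eqP => _; rewrite ?rmorph0 //; case: eqP.
- by rewrite hornerM hornerXn eE.
Qed.

(* Letting z become complex first (closure_umb_real) and y afterwards keeps each
   family one-parametric. *)
Lemma closure_umb (y z : R[i]) :
  z ^+ 2 * umb_den (rc b) y z != 0 ->
  zariski_closure (@Cr32 R) (umb_pair (rc b) y z).
Proof.
move=> h; apply: zariski_closure_idem.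
pose q : {poly R[i]} := 1 - (rc b)%:P * 'X ^+ 2.
have qE t : q.[t] = 1 - rc b * t ^+ 2.
  by rewrite /q hornerD hornerN hornerCM hornerXn hornerC.
pose e : {poly R[i]} := (rc b ^+ 2 * z ^+ 2)%:P * 'X ^+ 2 + q ^+ 2.
have eE t : e.[t] = umb_den (rc b) t z.
  by rewrite /e hornerD hornerCM hornerXn horner_exp qE /umb_den; ring.
apply: (@zariski_closure_curve _ ((z ^+ 2)%:P * e) _ _ (fun t => umb_pair (rc b) t z) y).
- apply: regular_pair_coords => l.
    have [li|li] := eqVneq l i.
      apply: regular_eq (@regular_frac _ ((z ^+ 2)%:P * e) ((rc b)%:P * q) e (z ^+ 2)%:P _) => [t|].
        by rewrite mxE li eqxx hornerCM qE eE.
      by rewrite mulrC.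
    have [lj|lj] := eqVneq l j.
      by apply: regular_eq (regularC _ (rc b)) => t; rewrite mxE (negPf li) lj eqxx.
    apply: regular_eq (@regular_frac _ ((z ^+ 2)%:P * e) q (z ^+ 2)%:P e _) => [t|//].
    by rewrite mxE (negPf li) (negPf lj) hornerC qE.
  have [li|li] := eqVneq l i.
    by apply: regular_eq (regularC _ 0) => t; rewrite mxE li eqxx.
  have [lj|lj] := eqVneq l j.
    by apply: regular_eq (regular_poly _ 'X) => t; rewrite mxE (negPf li) lj eqxx hornerX.
  by apply: regular_eq (regularC _ z) => t; rewrite mxE (negPf li) (negPf lj).
- by move=> t; rewrite hornerM hornerC eE; exact: closure_umb_real.
- by rewrite hornerM hornerC eE.
Qed.

End UmbilicFamily.

(** For the converse, a vertex belongs to the axis family, and an umbilic to the umbilic family with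
    b = a_j real and y, z complex. *)
Lemma complex_CrP (a : 'rV[R]_3) (x : 'rV[R[i]]_3) :
  (forall i, a 0 i != 0) -> (forall i j, i != j -> a 0 i != a 0 j) ->
  complex_Cr (quadric a) x <-> squares x \in special_squares (map_mx rc a).
Proof.
move=> a0 aa; split; first exact: complex_Cr_special.
have a0' i : map_mx rc a 0 i != 0 by rewrite mxE fmorph_eq0.
have aa' i j : i != j -> map_mx rc a 0 i != map_mx rc a 0 j.
  by move=> ij; rewrite !mxE (inj_eq (fmorph_inj _)) aa.
rewrite mem_cat => /orP[] /mapP[i _ h]; have [j [k d]] := distinct3_ex i.
  have [xj xk] := squares_axisP a0' h d; rewrite mxE.
  exact: complex_Cr_axis d xj xk.
have [xi ax hU] := squares_umbilicP a0' aa' h d.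
have /and3P[ij ik jk] := d.
have zk : x 0 k != 0.
  have := umbilic_squares_neq0 a0' aa' (_ : k != i); rewrite -h mxE eq_sym => /(_ ik).
  by rewrite expf_eq0.
move: ax hU; have := a0' i; have := a0' j; have := a0' k; rewrite !mxE.
set y := x 0 j in zk *; set z := x 0 k in zk *.
move=> ak aj ai ax hU.
(* The equation of the quadric recovers a_k from y and z, and the umbilic condition then recovers
   a_i. *)
have akE : rc (a 0 k) = (1 - rc (a 0 j) * y ^+ 2) / z ^+ 2.
  by rewrite -ax addrC addKr mulfK ?expf_neq0.
have e0E : rc (a 0 i) * umb_den (rc (a 0 j)) y z = rc (a 0 j) * (1 - rc (a 0 j) * y ^+ 2).
  have h1 : 1 - rc (a 0 j) * y ^+ 2 = rc (a 0 k) * z ^+ 2 by rewrite -ax; ring.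
  apply/eqP; rewrite -subr_eq0; apply/eqP.
  transitivity (z ^+ 2 * (rc (a 0 k) * rc (a 0 j) *
      (rc (a 0 j) * y ^+ 2 + rc (a 0 k) * z ^+ 2 - 1) +
    ((rc (a 0 i) - rc (a 0 k)) * (rc (a 0 j) * y) ^+ 2 +
     (rc (a 0 i) - rc (a 0 j)) * (rc (a 0 k) * z) ^+ 2))).
    by rewrite /umb_den h1; ring.
  by rewrite hU ax; ring.
(* Otherwise the right-hand side of [e0E], which equals a_j a_k z^2, would vanish. *)
have e0 : umb_den (rc (a 0 j)) y z != 0.
  apply: contra_eq_neq e0E => ->; rewrite mulr0 eq_sym mulf_neq0 //.
  by apply: contraNneq ak; rewrite akE => ->; rewrite mul0r.
rewrite /complex_Cr /= complexify_quadric.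
have -> : map_mx rc a = umb_coef i j (rc (a 0 j)) y z.
  apply/rowP => l; rewrite !mxE.
  have /or3P[/eqP->|/eqP->|/eqP->] := distinct3P l d; rewrite ?eqxx.
  - by rewrite -e0E mulfK.
  - by rewrite eq_sym (negPf ij).
  - by rewrite eq_sym (negPf ik) eq_sym (negPf jk).
have -> : x = umb_point i j y z.
  apply/rowP => l; rewrite !mxE.
  have /or3P[/eqP->|/eqP->|/eqP->] := distinct3P l d; rewrite ?eqxx //.
  - by rewrite eq_sym (negPf ij).
  - by rewrite eq_sym (negPf ik) eq_sym (negPf jk).
by apply: (closure_umb d); rewrite mulf_neq0 ?expf_neq0.
Qed.

End LowerBound.

(** * The excluded hypersurface and the sign cases *)

Definition generic_poly (R : realType) : {mpoly R[3]} :=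
  'X_0 * 'X_1 * 'X_(2%:R) * (('X_0 - 'X_1) * ('X_0 - 'X_(2%:R)) * ('X_1 - 'X_(2%:R))).

Lemma eval_generic_poly (R : realType) (v : 'I_3 -> R) :
  (generic_poly R).@[v] = v 0 * v 1 * v 2%:R *
    ((v 0 - v 1) * (v 0 - v 2%:R) * (v 1 - v 2%:R)).
Proof. by rewrite /generic_poly !(mevalM, mevalB, mevalXU). Qed.

Theorem theorem4p2 (R : realType) :
  for_general (fun a : 'rV[R]_3 =>
    (complex_Cr (quadric a) #= `I_18) /\
    (num_pos a = 3%N -> Cr (quadric a) #= `I_10) /\
    (num_pos a = 2%N /\ num_neg a = 1%N -> Cr (quadric a) #= `I_4) /\
    (num_pos a = 1%N /\ num_neg a = 2%N -> Cr (quadric a) #= `I_6) /\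
    (num_neg a = 3%N -> Cr (quadric a) #= `I_0)).
Proof.
exists (generic_poly R).
  (* The value at (1, 2, 3) is nonzero. *)
  apply/eqP => /(congr1 (meval (fun i : 'I_3 => i.+1%:R))).
  rewrite meval0 eval_generic_poly => /eqP; apply/negP.
  by rewrite !mulf_neq0 ?subr_eq0 ?eqr_nat ?pnatr_eq0.
move=> a; rewrite eval_generic_poly !mulf_eq0 !subr_eq0 !negb_or.
case/andP => /andP[/andP[h0 h1] h2] /andP[/andP[h01 h02] h12].
have a0 : forall i, a 0 i != 0 by apply: ord3P.
have aa i j : i != j -> a 0 i != a 0 j.
  by elim/ord3P: i; elim/ord3P: j => // _; rewrite eq_sym.
(* Two vertices for each positive coefficient and four umbilics when the product of the coefficients
   is positive: 6 + 4, 4 + 0, 2 + 4 and 0 + 0 in the four cases. *)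
have card_Cr : Cr (quadric a) #= `I_(num_pos a * 2 +
    (((0 < a 0 0) == (0 < a 0 1)) == (0 < a 0 2%:R))%R * 4)%N.
  rewrite num_posE -sum_special_real //.
  apply: (card_squares (@real_rootsP R) (@real_roots_uniq R)).
    exact: special_squares_uniq.
  by move=> x; exact: Cr_quadricP.
split.
  rewrite -(@sum_special_complex R (map_mx (real_complex R) a)).
  - apply: (card_squares (@complex_rootsP R) (@complex_roots_uniq R)).
      apply: special_squares_uniq.
      + by move=> i; rewrite mxE fmorph_eq0.
      + by move=> i j ij; rewrite !mxE (inj_eq (fmorph_inj _)) aa.
    by move=> x; exact: complex_CrP.
  - by move=> i; rewrite mxE fmorph_eq0.
  - by move=> i j ij; rewrite !mxE (inj_eq (fmorph_inj _)) aa.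
move: card_Cr; rewrite num_negE // num_posE.
case: (0 < a 0 0); case: (0 < a 0 1); case: (0 < a 0 2%:R) => /= card_Cr;
  by do ![split] => //; case.
Qed.
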